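(* Let $(X,T)$ be a Polish dynamical system with the strong approximate product structure with respect to a compatible metric $\rho$, and suppose there are at least two $T$-invariant Borel probability measures on $X$. Then (1) the quasi-regular set $Q(X,T)$ is $\boldsymbol{\Pi}^0_3$-hard, and thus $Q(X,T)$ is $\boldsymbol{\Pi}^0_3$-complete; (2) the irregular set $I(X,T)$ is $\boldsymbol{\Sigma}^0_3$-hard, and thus $I(X,T)$ is $\boldsymbol{\Sigma}^0_3$-complete.
   Context: A Polish dynamical system $(X,T)$ is a Polish space $X$ with a fixed compatible complete metric $\rho$ and a continuous map $T\colon X\to X$ ($X$ not assumed compact). For bounded continuous $\varphi\colon X\to\mathbb{R}$ and $k\ge 1$, $A_k\varphi(x)=\frac1k\sum_{j=0}^{k-1}\varphi(T^j(x))$, and $I_\varphi(X,T)$ is the set of $x\in X$ for which $(A_k\varphi(x))_{k\ge 1}$ does not converge. The irregular set $I(X,T)$ is the union of $I_\varphi(X,T)$ over all bounded continuous $\varphi\colon X\to\mathbb{R}$; the quasi-regular set is $Q(X,T)=X\setminus I(X,T)$. Strong approximate product structure: a specification is a finite sequence $\xi=(\langle x_j,n_j\rangle)_{j=1}^k$ with $x_j\in X$, $n_j\ge1$, $k\ge 1$. For finite $\Lambda\subseteq\{0,1,2,\dots\}$, $B_\Lambda(x,\varepsilon)=\{y:\rho(T^j x,T^j y)<\varepsilon\ \forall j\in\Lambda\}$, and $B_n=B_{\{0,\dots,n-1\}}$. A point $y$ $(\varepsilon,\delta_1,\delta_2)$-approximately-traces $\xi$ if $y\in B_{n_1}(x_1,\varepsilon)$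 and for each $2\le j\le k$ there are $\Lambda_j\subseteq\{0,\dots,n_j-1\}$ with $|\Lambda_j|\ge(1-\delta_1)n_j$ and an integer $0\le s_{j-1}\le\delta_2 n_j$ such that $T^{\sum_{i=1}^{j-1}(s_i+n_i)}(y)\in B_{\Lambda_j}(x_j,\varepsilon)$. $(X,T)$ has the strong approximate product structure if for all $\varepsilon,\delta_1,\delta_2>0$ there is a nonnegative integer $N$ such that for every specification with all $n_j\ge N$ there is a point $y\in X$ that $(\varepsilon,\delta_1,\delta_2)$-approximately-traces it. Borel hierarchy: $\boldsymbol{\Sigma}^0_1$ = open sets, $\boldsymbol{\Pi}^0_n$ = complements of $\boldsymbol{\Sigma}^0_n$ sets, $\boldsymbol{\Sigma}^0_{n+1}$ = countable unions of $\boldsymbol{\Pi}^0_n$ sets. $A$ is $\boldsymbol{\Pi}^0_3$-hard if $A\notin\boldsymbol{\Sigma}^0_3$ and $\boldsymbol{\Pi}^0_3$-complete if $A\in\boldsymbol{\Pi}^0_3\setminus\boldsymbol{\Sigma}^0_3$; $A$ is $\boldsymbol{\Sigma}^0_3$-hard if $A\notin\boldsymbol{\Pi}^0_3$ and $\boldsymbol{\Sigma}^0_3$-complete if $A\in\boldsymbol{\Sigma}^0_3\setminus\boldsymbol{\Pi}^0_3$. *)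

(* Defs.v *)
From HB Require Import structures.
From mathcomp Require Import all_boot all_order all_algebra.
From mathcomp Require Import all_classical all_reals all_analysis.

Set Implicit Arguments.
Unset Strict Implicit.
Unset Printing Implicit Defensive.

Import Order.TTheory GRing.Theory Num.Theory.
Import numFieldNormedType.Exports.

Local Open Scope classical_set_scope.
Local Open Scope ring_scope.

(* Completeness comes with a base point in the library; this excludes only the
   empty space, which carries no probability measure. *)
#[short(type="completeMetricType")]
HB.structure Definition CompleteMetric (K : numDomainType) :=
  {X of Metric K X & Complete X}.

Definition separable (X : topologicalType) : Prop :=
  exists2 D : set X, countable D & dense D.

(* Only the levels n >= 1 are meaningful; level 0 is a placeholder. *)
Fixpoint Sigma0 (X : topologicalType) (n : nat) : set (set X) :=
  match n with
  | 0%N => set0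
  | 1%N => open
  | m.+1 => [set A | exists2 F : (set X)^nat,
               (forall i, Sigma0 m (~` F i)) & A = \bigcup_i F i]
  end.

Definition Pi0 (X : topologicalType) (n : nat) : set (set X) :=
  [set A | Sigma0 n (~` A)].

Definition Pi0_hard (X : topologicalType) (n : nat) (A : set X) : Prop :=
  ~ Sigma0 n A.

Definition Pi0_complete (X : topologicalType) (n : nat) (A : set X) : Prop :=
  Pi0 n A /\ ~ Sigma0 n A.

Definition Sigma0_hard (X : topologicalType) (n : nat) (A : set X) : Prop :=
  ~ Pi0 n A.

Definition Sigma0_complete (X : topologicalType) (n : nat) (A : set X) : Prop :=
  Sigma0 n A /\ ~ Pi0 n A.

Section BirkhoffAverages.
Context {R : realType} {X : topologicalType}.
Implicit Types (T : X -> X) (phi : X -> R).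

Definition birkhoff_avg T phi (k : nat) (x : X) : R :=
  k%:R^-1 * \sum_(j < k) phi (iter j T x).

(* The junk term k = 0 of the sequence does not affect convergence. *)
Definition irregular_for T phi : set X :=
  [set x | ~ cvg (birkhoff_avg T phi k x @[k --> \oo])].

End BirkhoffAverages.

Definition irregular_set (R : realType) (X : topologicalType) (T : X -> X) :
    set X :=
  \bigcup_(phi in [set phi : X -> R | continuous phi /\ bounded_fun phi])
    irregular_for T phi.

Definition quasi_regular_set (R : realType) (X : topologicalType)
    (T : X -> X) : set X :=
  ~` irregular_set R T.

Notation borel_type X := (g_sigma_algebraType (@open X)).

Definition invariant_measure (R : realType) (X : ptopologicalType)
    (T : X -> X) (mu : probability (borel_type X) R) : Prop :=
  forall A : set (borel_type X), measurable A -> mu (T @^-1` A) = mu A.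

(* Measures are total functions whose values off the sigma-algebra carry no
   information, so distinctness is tested on Borel sets. *)
Definition two_invariant_measures (R : realType) (X : ptopologicalType)
    (T : X -> X) : Prop :=
  exists mu nu : probability (borel_type X) R,
    [/\ invariant_measure T mu, invariant_measure T nu &
        exists2 A : set (borel_type X), measurable A & mu A <> nu A].

Section StrongApproximateProductStructure.
Context {R : realType} {X : metricType R}.
Implicit Types (T : X -> X).

Definition dyn_ball T (n : nat) (L : {set 'I_n}) (x : X) (e : R) : set X :=
  [set y | forall j : 'I_n, j \in L -> mdist (iter j T x) (iter j T y) < e].

(* A specification of length k.+1 is a map xi : 'I_k.+1 -> X * nat; indices
   start at 0, so s i is the gap between the segments i and i.+1. *)
Definition approx_traces T (e d1 d2 : R) (k : nat) (xi : 'I_k.+1 -> X * nat)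
    (y : X) : Prop :=
  dyn_ball T [set: 'I_((xi ord0).2)]%SET (xi ord0).1 e y /\
  exists s : nat -> nat, forall j : 'I_k.+1, (0 < j)%N ->
    (s j.-1)%:R <= d2 * (xi j).2%:R /\
    exists2 L : {set 'I_((xi j).2)},
      (1 - d1) * (xi j).2%:R <= #|L|%:R &
      dyn_ball T L (xi j).1 e
        (iter (\sum_(i < k.+1 | (i < j)%N) (s i + (xi i).2))%N T y).

Definition strong_approximate_product_structure T : Prop :=
  forall e d1 d2 : R, 0 < e -> 0 < d1 -> 0 < d2 ->
    exists N : nat, forall (k : nat) (xi : 'I_k.+1 -> X * nat),
      (forall j, (1 <= (xi j).2)%N) -> (forall j, (N <= (xi j).2)%N) ->
      exists y : X, approx_traces T e d1 d2 xi y.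

End StrongApproximateProductStructure.

(* Main.v *)
Require Import Defs.
From mathcomp Require Import all_boot all_order all_algebra.
From mathcomp Require Import all_classical all_reals all_analysis.
From mathcomp Require Import measurable_realfun ring lra zify.
Import Order.TTheory GRing.Theory Num.Theory.
Import numFieldNormedType.Exports.

Set Implicit Arguments.
Unset Strict Implicit.
Unset Printing Implicit Defensive.

Local Open Scope classical_set_scope.
Local Open Scope ring_scope.

(* A quasi-regular point has a tight orbit: otherwise a positive proportion of the
   orbit escapes to infinity, and a gliding hump produces a bounded continuous function
   with oscillating averages.  Conversely, along a tight orbit every bounded continuous
   function is approximated by members of a countable family of Lipschitz functions.
   Tightness together with convergence on this family is a countable intersection of
   countable unions of closed conditions.

   For the lower bound, a sequence a of naturals is mapped continuously to a point Y a
   obtained by tracing longer and longer stages.  A stage follows blocks that sample the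
   invariant measure mu (chosen greedily so that all running averages are close to the
   mu-means), and then blocks biased towards a second measure nu, which take up a
   proportion of about 1 / (a i + 2) of the elapsed time.  The averages of Y a converge
   to the mu-means when a tends to infinity, and oscillate when a takes some value
   infinitely often; and the set of sequences tending to infinity is not Sigma^0_3, by a
   direct diagonal argument. *)

(** Without compactness, convergence on a countable family of functions does not exclude that mass
    escapes along the orbit; tightness is the condition that closes this gap. In the lower bound,
    tightness of [Y a] for [a] tending to infinity is inherited from [mu]: the functions that
    express tightness belong to the countable family, so their averages along [Y a] tend to their
    [mu]-means. Neither measure is assumed ergodic, so generic points are not at hand. Greedy
    sampling takes their place; it only uses that a bounded continuous function takes values close
    to or below its mean. Two features make the stages fit together. The first segment of a
    specification is shadowed at all its times and without a gap, so the successive points converge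
    and late entries of [a] move [Y a] only slightly. Moreover, each stage is much longer than all
    the time before it, so the trivial bound on the past suffices and old errors do not
    accumulate. *)

(** * Sequences tending to infinity are not Sigma^0_3 in Baire space *)

Section BaireSpaceDiagonalisation.
Local Open Scope nat_scope.
Implicit Types (a b c : nat -> nat) (U : set (nat -> nat)).

Definition agree (n : nat) (a b : nat -> nat) : Prop :=
  forall k, k < n -> a k = b k.

Definition baire_open U : Prop :=
  forall a, U a -> exists n, forall b, agree n a b -> U b.

Definition to_infinity (a : nat -> nat) : Prop :=
  forall i, exists n, forall k, n <= k -> i <= a k.

(** Entry [k] is settled by stage [k.+1], because [n k.+1 > k]; hence the diagonal reading of the
    limit. *)
Lemma agree_limit (n : nat -> nat) (b : nat -> nat -> nat) :
  (forall j, n j < n j.+1) -> (forall j, agree (n j) (b j) (b j.+1)) ->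
  forall j, agree (n j) (b j) (fun k => b k.+1 k).
Proof.
move=> nS bS; have n_ge j : j <= n j.
  by elim: j => // j IH; apply: leq_ltn_trans IH (nS j).
have n_mono i j : i <= j -> n i <= n j.
  elim: j => [|j IH]; first by rewrite leqn0 => /eqP ->.
  rewrite leq_eqVlt => /orP[/eqP->//|]; rewrite ltnS => /IH h.
  exact: leq_trans h (ltnW (nS j)).
have mono i d : agree (n i) (b i) (b (i + d)).
  elim: d => [|d IH] k kn; first by rewrite addn0.
  rewrite addnS -bS ?IH//; apply: leq_trans kn (n_mono _ _ _).
  exact: leq_addr.
move=> j k kn; have [jk|kj] := leqP j k.+1.
  by rewrite (mono j (k.+1 - j))// subnKC.
have kS : k < n k.+1 by exact: n_ge.
by rewrite (mono k.+1 (j - k.+1) k kS) subnKC// ltnW.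
Qed.

(* Below a position, either some extension with entries larger than i from then on
   can never enter U j, or one can enter all the U j while playing i infinitely often. *)
Lemma avoid_G_delta (i : nat) (U : nat -> set (nat -> nat)) :
  (forall j, baire_open (U j)) ->
  (forall a, (forall j, U j a) -> to_infinity a) ->
  forall n a, exists n' b, [/\ n < n', agree n a b, forall k, n <= k -> i <= b k &
    exists j, forall c, agree n' b c -> (forall k, n' <= k -> i < c k) -> ~ U j c].
Proof.
move=> Uopen Uinf n a.
apply: contrapT => H.
pose valid n' b := [/\ n < n', agree n a b & forall k, n <= k -> i <= b k].
(* If the claim fails, each [U j] can be entered from every valid position with entries above
   [i]. *)
have ext n' b : valid n' b -> forall j, exists c,
    [/\ agree n' b c, forall k, n' <= k -> i < c k & U j c].
  move=> [nn' ab bi] j; apply: contrapT => K; apply: H.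
  exists n', b; split=> //; exists j => c bc ci Uc; apply: K.
  by exists c; split.
pose set_tail N c := fun k => if k < N then c k else i.
have step (p : nat * (nat -> nat)) j : exists q : nat * (nat -> nat),
    valid p.1 p.2 -> [/\ valid q.1 q.2, p.1 < q.1, agree p.1 p.2 q.2,
       q.2 q.1.-1 = i & forall c, agree q.1 q.2 c -> U j c].
  have [v|nv] := pselect (valid p.1 p.2); last by exists p.
  have [c [pc ci Ujc]] := ext _ _ v j.
  have [N UN] := Uopen j _ Ujc.
  (* The successor puts one entry of the constant tail into the settled prefix, so each step records
     a further occurrence of [i]. *)
  exists ((maxn N p.1).+1, set_tail (maxn N p.1) c) => _ /=.
  have [np ap bi] := v.
  have st k : k < maxn N p.1 -> set_tail (maxn N p.1) c k = c k.
    by rewrite /set_tail => ->.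
  split.
  - split=> /=.
    + by rewrite (ltn_trans np)// ltnS leq_maxr.
    + move=> k kn; have kp := ltn_trans kn np.
      by rewrite st ?leq_max ?kp ?orbT// -pc// ap.
    + move=> k nk; rewrite /set_tail; case: ifP => // kM.
      have [kp|pk] := ltnP k p.1; first by rewrite -pc// bi.
      exact/ltnW/ci.
  - by rewrite ltnS leq_maxr.
  - by move=> k kp; rewrite st ?leq_max ?kp ?orbT// pc.
  - by rewrite /set_tail ltnn.
  - move=> d cd; apply: UN => k kN; rewrite -cd ?st// ?leq_max ?kN//.
    by rewrite ltnS leq_max (ltnW kN).
have [f fP] := choice (fun pj : (nat * (nat -> nat)) * nat => step pj.1 pj.2).
pose s := fix s j := if j is j'.+1 then f (s j', j') else (n.+1, set_tail n a).
have sv j : valid (s j).1 (s j).2.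
  elim: j => [|j IH]; last by have [] := fP (s j, j) IH.
  split=> //= k; first by move=> kn; rewrite /set_tail kn.
  by move=> nk; rewrite /set_tail ltnNge nk.
have sP j := fP (s j, j) (sv j).
pose b k := (s k.+1).2 k.
have bagree : forall j, agree (s j).1 (s j).2 b.
  apply: (@agree_limit (fun j => (s j).1) (fun j => (s j).2)) => j;
  by have [] := sP j.
have Ub j : U j b by have [_ _ _ _] := sP j; apply; exact: (bagree j.+1).
have [N bN] := Uinf b Ub i.+1.
have s_ge j : j < (s j).1.
  elim: j => [|j IH]; first by [].
  by have [_ + _ _ _] := sP j; exact: leq_ltn_trans.
(* [b] lies in every [U j] and so tends to infinity, yet it takes the value [i] at the last position
   of every settled prefix. *)
have [_ _ _ lasti _] := sP N.
have := bN (s N.+1).1.-1; rewrite -(bagree N.+1); last first.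
  by rewrite prednK// (leq_ltn_trans _ (s_ge N.+1)).
rewrite lasti ltnn => h; have : false; last by [].
by apply: h; have := s_ge N.+1; lia.
Qed.

(** Step [i] of the diagonal argument defeats the [i]-th G_delta set with entries at least [i]. All
    later steps play entries above [i], which is the proviso of [avoid_G_delta]; the limit tends to
    infinity and lies in none of the G_delta sets. *)
Lemma to_infinity_not_Sigma3 (U : nat -> nat -> set (nat -> nat)) :
  (forall i j, baire_open (U i j)) ->
  ~ (forall a, to_infinity a <-> exists i, forall j, U i j a).
Proof.
move=> Uopen UE.
have main i (p : nat * (nat -> nat)) : exists q : nat * (nat -> nat),
  [/\ p.1 < q.1, agree p.1 p.2 q.2, forall k, p.1 <= k -> i <= q.2 k &
    exists j, forall c, agree q.1 q.2 c -> (forall k, q.1 <= k -> i < c k) ->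
      ~ U i j c].
  have [|n [b bP]] := @avoid_G_delta i (U i) (Uopen i) _ p.1 p.2.
    by move=> a Ua; apply/UE; exists i.
  by exists (n, b).
have [f fP] := choice (fun ip : nat * (nat * (nat -> nat)) => main ip.1 ip.2).
pose s := fix s j := if j is j'.+1 then f (j', s j') else (0, fun=> 0).
have sP j := fP (j, s j).
pose a k := (s k.+1).2 k.
have a_agree : forall j, agree (s j).1 (s j).2 a.
  apply: (@agree_limit (fun j => (s j).1) (fun j => (s j).2)) => j;
  by have [] := sP j.
have large i l k : i < l -> (s i).1 <= k -> i <= (s l).2 k.
  elim: l => // l IH; rewrite ltnS leq_eqVlt => /orP[/eqP -> sk|il sk].
    by have [_ _ + _] := sP l; apply.
  have [h1 h2 h3 _] := sP l; have [kl|lk] := ltnP k (s l).1.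
    by rewrite -(h2 k kl) IH.
  exact: leq_trans (ltnW il) (h3 k lk).
have s_ge j : j <= (s j).1.
  by elim: j => // j IH; have [+ _ _ _] := sP j; exact: leq_ltn_trans.
have a_large i k : (s i).1 <= k -> i <= a k.
  move=> sk; have := large i k.+1 k; apply=> //.
  by rewrite ltnS (leq_trans (s_ge i)).
have /UE[i Ui] : to_infinity a by move=> i; exists (s i).1 => k; exact: a_large.
have [_ _ _ [j jP]] := sP i.
by apply: (jP a (a_agree i.+1) _ (Ui j)) => k; exact: (a_large i.+1).
Qed.

End BaireSpaceDiagonalisation.

(** * Birkhoff sums along traced specifications *)

Definition unit_valued (R : realType) (X : Type) (f : X -> R) : Prop :=
  forall x, 0 <= f x <= 1.

Section BirkhoffSums.
Context {R : realType} {X : Type}.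
Implicit Types (T : X -> X) (f : X -> R).

Definition bsum T f (k : nat) (x : X) : R := \sum_(j < k) f (iter j T x).

Lemma bsumD T f k l x :
  bsum T f (k + l) x = bsum T f k x + bsum T f l (iter k T x).
Proof.
rewrite /bsum big_split_ord; congr (_ + _); apply: eq_bigr => j _ /=.
by rewrite addnC iterD.
Qed.

Lemma bsum0 T f x : bsum T f 0 x = 0.
Proof. by rewrite /bsum big_ord0. Qed.

Lemma bsum_ge0 T f k x : (forall y, 0 <= f y) -> 0 <= bsum T f k x.
Proof. by move=> f0; apply: sumr_ge0 => j _. Qed.

Lemma bsum_unit T f k x : unit_valued f -> 0 <= bsum T f k x <= k%:R.
Proof.
move=> f01; rewrite bsum_ge0 /=; last by move=> y; case/andP: (f01 y).
rewrite -[leRHS]mulr1 mulr_natl -[X in _ *+ X]card_ord -sumr_const.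
by apply: ler_sum => j _; case/andP: (f01 (iter j T x)).
Qed.

Lemma bsum_dist T f k (e : R) x y :
  (forall j, (j < k)%N -> `|f (iter j T x) - f (iter j T y)| <= e) ->
  `|bsum T f k x - bsum T f k y| <= e * k%:R.
Proof.
move=> fe; rewrite /bsum -sumrB (le_trans (ler_norm_sum _ _ _))//.
rewrite mulr_natr -[X in _ *+ X]card_ord -sumr_const.
by apply: ler_sum => j _; apply: fe.
Qed.

End BirkhoffSums.

Section Tracing.
Context {R : realType} {X : metricType R}.
Implicit Types (T : X -> X) (h : X -> R).

(** At most [e * m] indices lie outside [L], and each costs at most 1 because [h] is unit-valued. *)
Lemma bsum_dyn_ball T h (m : nat) (L : {set 'I_m}) (x y : X) (e w : R) :
  unit_valued h -> (forall u v, mdist u v < e -> `|h u - h v| <= w) -> 0 <= w ->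
  0 <= e -> (1 - e) * m%:R <= #|L|%:R -> dyn_ball T L x e y ->
  `|bsum T h m y - bsum T h m x| <= (w + e) * m%:R.
Proof.
move=> h01 hw w0 e0 Lm xLy; rewrite /bsum -sumrB (le_trans (ler_norm_sum _ _ _))//.
have bd (i : 'I_m) : `|h (iter i T y) - h (iter i T x)| <= w + (i \notin L)%:R.
  have [iL|iL] := boolP (i \in L); first by rewrite addr0 distrC hw// xLy.
  have /andP[a0 a1] := h01 (iter i T y); have /andP[b0 b1] := h01 (iter i T x).
  by rewrite ler_norml; apply/andP; split; rewrite /=; lra.
apply: le_trans (ler_sum _ (fun i _ => bd i)) _.
rewrite big_split /= sumr_const card_ord.
have -> : \sum_(i < m) (i \notin L)%:R = (m - #|L|)%:R :> R.
  rewrite -natr_sum; congr (_%:R); rewrite -[RHS](_ : #|~: L|%SET = _).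
    by rewrite -sum1_card [RHS]big_mkcond; apply: eq_bigr => i _; rewrite inE; case: (i \in L).
  by rewrite cardsCs finset.setCK card_ord.
have Lm' : (#|L| <= m)%N by rewrite -[leqRHS]card_ord max_card.
rewrite natrB// -mulr_natr; lra.
Qed.

(* The length t + q * m ignores the gaps, whose total length is at most e * q * m. *)
Lemma trace_append T (e : R) : strong_approximate_product_structure T -> 0 < e ->
  exists N : nat, forall y (t m c : nat) (w : nat -> X),
    (0 < t)%N -> (0 < m)%N -> (N <= t)%N -> (N <= m)%N ->
    exists y', (forall j, (j < t)%N -> mdist (iter j T y) (iter j T y') < e) /\
    forall h (om : R), unit_valued h -> 0 <= om ->
      (forall u v, mdist u v < e -> `|h u - h v| <= om) ->
      forall q, (q <= c)%N ->
      `|bsum T h (t + q * m) y' - bsum T h t y - \sum_(l < q) bsum T h m (w l)|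
        <= om * (t + q * m)%:R + 3 * e * (q * m)%:R.
Proof.
move=> saps e0; have [N NP] := saps e e e e0 e0 e0.
exists N => y t m c w t0 m0 Nt Nm.
pose xi (i : 'I_c.+1) := if val i is i'.+1 then (w i', m) else (y, t).
have [||y' [y'0 [s y's]]] := NP c xi.
- by move=> [[|j] ?].
- by move=> [[|j] ?].
exists y'; split.
  by move=> j jt; have := y'0 (Ordinal jt); rewrite inE; exact.
move=> h om h01 om0 hom.
pose sg q := (\sum_(l < q) s l)%N.
have sgS q : sg q.+1 = (sg q + s q)%N by rewrite /sg big_ord_recr.
have sums q : (q < c)%N ->
    (\sum_(i < c.+1 | (i < q.+1)%N) (s i + (xi i).2) = t + q * m + sg q.+1)%N.
  move=> qc; pose G i := (s i + (if i is _.+1 then m else t))%N.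
  rewrite (eq_bigr (fun i : 'I_c.+1 => G i)); last by move=> [[|i] ?] _.
  rewrite -(big_ord_widen _ G) 1?ltnW//.
  elim: q {qc} => [|q IH]; first by rewrite /sg !big_ord_recl !big_ord0 /G /=; lia.
  by rewrite big_ord_recr /= IH (sgS q.+1) /G /=; lia.
have sb q : (q < c)%N -> (s q)%:R <= e * m%:R.
  move=> qc; have qc' : (q.+1 < c.+1)%N by [].
  by have [] := y's (Ordinal qc') isT.
have sgb q : (q <= c)%N -> (sg q)%:R <= e * (q * m)%:R.
  elim: q => [|q IH] qc; first by rewrite /sg big_ord0 mul0n mulr0.
  have := IH (ltnW qc); have := sb q qc.
  by rewrite sgS mulSn !natrD; lra.
(* At the true time, gaps included, each block costs [2 * e * m]: one part for the gap before it,
   one for its untraced indices. *)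
have main q : (q <= c)%N ->
    `|bsum T h (t + q * m + sg q) y' - bsum T h t y - \sum_(l < q) bsum T h m (w l)|
        <= om * (t + q * m)%:R + 2 * e * (q * m)%:R.
  elim: q => [_|q IH qc].
    rewrite /sg !big_ord0 mul0n !addn0 !mulr0 subr0 addr0.
    by apply: bsum_dist => j jt; rewrite distrC hom// (y'0 (Ordinal jt)) ?inE.
  have {IH} := IH (ltnW qc).
  have qc' : (q.+1 < c.+1)%N by [].
  have [_ [L Lm]] := y's (Ordinal qc') isT.
  rewrite (sums q qc) /= => /(bsum_dyn_ball h01 hom om0 (ltW e0) Lm).
  have -> : (t + q.+1 * m + sg q.+1 = t + q * m + sg q + (s q + m))%N.
    by rewrite sgS; lia.
  rewrite (bsumD _ _ (t + q * m + sg q)) (bsumD _ _ (s q) m) -iterD big_ord_recr /=.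
  have -> : (s q + (t + q * m + sg q) = t + q * m + sg q.+1)%N by rewrite sgS; lia.
  have /andP[] := bsum_unit T (s q) (iter (t + q * m + sg q) T y') h01.
  have := sb q qc.
  have -> : (t + q.+1 * m)%:R = (t + q * m)%:R + m%:R :> R by rewrite -natrD; congr (_%:R); lia.
  have -> : (q.+1 * m)%:R = (q * m)%:R + m%:R :> R by rewrite -natrD; congr (_%:R); lia.
  move: (bsum _ _ (s q) _) (bsum _ _ _ y') (bsum _ _ t y) (\sum_(l < q) _) => a b c' d.
  move: (bsum _ _ _ _) (bsum _ _ _ _) => a1 a2 ? ? ? .
  rewrite !ler_norml => /andP[? ?] /andP[? ?].
  by apply/andP; split; lra.
(* Dropping the last [sg q] iterates costs the third multiple of [e]. *)
move=> q qc; have := main q qc; rewrite bsumD.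
have /andP[] := bsum_unit T (sg q) (iter (t + q * m) T y') h01.
have := sgb q qc.
move: (bsum _ _ (sg q) _) (bsum _ _ _ y') (bsum _ _ t y) (\sum_(l < q) _) => a b c' d.
move=> ? ? ?; rewrite !ler_norml => /andP[? ?].
by apply/andP; split; lra.
Qed.

End Tracing.

(** * Bounded continuous functions and their means *)

Section BoundedContinuous.
Context {R : realType} {X : topologicalType}.
Implicit Types (f g : X -> R) (T : X -> X).

Definition bounded_continuous f : Prop :=
  continuous f /\ exists B : R, forall x, `|f x| <= B.

Lemma bounded_continuous_cst (c : R) : bounded_continuous (fun=> c).
Proof. by split; [move=> x; exact: cvg_cst | exists `|c|]. Qed.

Lemma bounded_continuousD f g : bounded_continuous f -> bounded_continuous g ->
  bounded_continuous (fun x => f x + g x).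
Proof.
move=> [cf [B fB]] [cg [C gC]]; split; first by move=> x; apply: cvgD; [exact: cf|exact: cg].
by exists (B + C) => x; rewrite (le_trans (ler_normD _ _))// lerD.
Qed.

Lemma bounded_continuousZ (c : R) f : bounded_continuous f ->
  bounded_continuous (fun x => c * f x).
Proof.
move=> [cf [B fB]]; split; first by move=> x; apply: cvgM; [exact: cvg_cst|exact: cf].
by exists (`|c| * B) => x; rewrite normrM ler_wpM2l.
Qed.

Lemma bounded_continuous_sum (I : Type) (r : seq I) (F : I -> X -> R) :
  (forall i, bounded_continuous (F i)) ->
  bounded_continuous (fun x => \sum_(i <- r) F i x).
Proof.
move=> bF; elim: r => [|i r IH].
  rewrite (_ : (fun _ => _) = fun=> 0); first exact: bounded_continuous_cst.
  by apply/funext => x; rewrite big_nil.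
rewrite (_ : (fun _ => _) = fun x => F i x + \sum_(i <- r) F i x).
  exact: bounded_continuousD.
by apply/funext => x; rewrite big_cons.
Qed.

Lemma unit_bounded_continuous f :
  continuous f -> unit_valued f -> bounded_continuous f.
Proof.
move=> cf f01; split=> //; exists 1 => x.
by have /andP[? ?] := f01 x; rewrite ger0_norm.
Qed.

Lemma continuous_iter T k : continuous T -> continuous (iter k T).
Proof.
move=> cT; elim: k => [|k IH] x; first exact: cvg_id.
by apply: continuous_comp; [exact: IH|exact: cT].
Qed.

Lemma bounded_continuous_iter T f k : continuous T -> bounded_continuous f ->
  bounded_continuous (fun x => f (iter k T x)).
Proof.
move=> cT [cf [B fB]]; split; last by exists B => x; exact: fB.
by move=> x; apply: continuous_comp; [exact: continuous_iter|exact: cf].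
Qed.

Lemma bounded_continuous_bsum T f k : continuous T -> bounded_continuous f ->
  bounded_continuous (bsum T f k).
Proof.
by move=> cT bf; apply: bounded_continuous_sum => j; exact: bounded_continuous_iter.
Qed.

End BoundedContinuous.

Section Mean.
Context {R : realType} {X : ptopologicalType} (mu : probability (borel_type X) R).
Implicit Types (f g : X -> R) (T : X -> X).

Definition mean f : R := Rintegral mu [set: borel_type X] f.

Lemma open_measurable_borel (U : set X) : open U -> measurable (U : set (borel_type X)).
Proof. by move=> oU; exact: sub_sigma_algebra. Qed.

Lemma continuous_measurable_borel f :
  continuous f -> measurable_fun [set: borel_type X] (f : borel_type X -> R).
Proof.
move=> cf; apply: (measurability _ (RGenOpens.measurableE R)).
move=> _ [_ [a [b ->] <-]]; rewrite setTI; apply: open_measurable_borel.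
by move/continuousP : cf; apply; exact: interval_open.
Qed.

Lemma bounded_continuous_integrable f :
  bounded_continuous f -> mu.-integrable [set: borel_type X] (EFin \o f).
Proof.
move=> [cf [B fB]]; apply: measurable_bounded_integrable => //.
- by rewrite [ltLHS](probability_setT mu) ltry.
- exact: continuous_measurable_borel.
- by exists B; split; [exact: num_real|move=> M BM x _; exact: le_trans (fB x) (ltW BM)].
Qed.

Lemma meanD f g : bounded_continuous f -> bounded_continuous g ->
  mean (fun x => f x + g x) = mean f + mean g.
Proof.
by move=> bf bg; rewrite /mean RintegralD//; exact: bounded_continuous_integrable.
Qed.

Lemma meanZ (c : R) f : bounded_continuous f ->
  mean (fun x => c * f x) = c * mean f.
Proof.
by move=> bf; rewrite /mean RintegralZl//; exact: bounded_continuous_integrable.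
Qed.

Lemma mean_cst (c : R) : mean (fun=> c) = c.
Proof. by rewrite /mean Rintegral_cst// [X in fine X](probability_setT mu) mulr1. Qed.

Lemma le_mean f g : bounded_continuous f -> bounded_continuous g ->
  (forall x, f x <= g x) -> mean f <= mean g.
Proof.
by move=> bf bg fg; apply: le_Rintegral => //; exact: bounded_continuous_integrable.
Qed.

Lemma mean_sum (I : Type) (r : seq I) (F : I -> X -> R) :
  (forall i, bounded_continuous (F i)) ->
  mean (fun x => \sum_(i <- r) F i x) = \sum_(i <- r) mean (F i).
Proof.
move=> bF; elim: r => [|i r IH].
  rewrite big_nil -[RHS]mean_cst; congr mean.
  by apply/funext => x; rewrite big_nil.
rewrite big_cons -IH -meanD//; last exact: bounded_continuous_sum.
by congr mean; apply/funext => x; rewrite big_cons.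
Qed.

Lemma mean_unit f : continuous f -> unit_valued f -> 0 <= mean f <= 1.
Proof.
move=> cf f01; have bf := unit_bounded_continuous cf f01.
have bc := @bounded_continuous_cst R X.
rewrite -[X in X <= _ <= _](mean_cst 0) -[X in _ <= _ <= X](mean_cst 1).
by apply/andP; split; apply: le_mean => // x; case/andP: (f01 x).
Qed.

Lemma exists_le_mean f (e : R) : bounded_continuous f -> 0 < e ->
  exists x, f x <= mean f + e.
Proof.
move=> bf e0; apply: contrapT => H.
have : mean (fun=> mean f + e) <= mean f.
  apply: le_mean => //; first exact: bounded_continuous_cst.
  by move=> x; rewrite leNgt; apply/negP => fx; apply: H; exists x; exact: ltW.
by rewrite mean_cst; lra.
Qed.

Lemma exists_ge_mean f (e : R) : bounded_continuous f -> 0 < e ->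
  exists x, mean f - e <= f x.
Proof.
move=> bf e0; have [x xP] := exists_le_mean (bounded_continuousZ (-1) bf) e0.
by exists x; move: xP; rewrite meanZ//; lra.
Qed.

Lemma mean_comp T f : continuous T -> invariant_measure T mu ->
  bounded_continuous f -> mean (fun x => f (T x)) = mean f.
Proof.
move=> cT iT bf; rewrite /mean /Rintegral; congr fine.
have mT : measurable_fun [set: borel_type X] (T : borel_type X -> borel_type X).
  apply: (@measurability _ _ (borel_type X) (borel_type X) setT T (@open X)) => //.
  move=> _ [U oU <-]; rewrite setTI; apply: open_measurable_borel.
  by move/continuousP : cT; apply.
have mf : @measurable_fun _ _ (borel_type X) (\bar R) setT (EFin \o f).
  by apply/measurable_EFinP; apply: continuous_measurable_borel; case: bf.
have := @integral_pushforward _ _ (borel_type X) (borel_type X) R T mT mu setT (EFin \o f) mf.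
rewrite preimage_setT => <- //; last first.
  apply: (@bounded_continuous_integrable (fun x => f (T x))).
  exact: (bounded_continuous_iter 1 cT bf).
by apply: eq_measure_integral => A mA _; exact: iT.
Qed.

Lemma mean_bsum T f k : continuous T -> invariant_measure T mu ->
  bounded_continuous f -> mean (bsum T f k) = k%:R * mean f.
Proof.
move=> cT iT bf; rewrite /bsum mean_sum; last first.
  by move=> j; exact: bounded_continuous_iter.
rewrite (eq_bigr (fun=> mean f)).
  by rewrite sumr_const card_ord mulr_natl.
move=> j _; elim: (j : nat) => // i IH; rewrite -IH.
rewrite -(mean_comp cT iT (bounded_continuous_iter i cT bf)).
by congr mean; apply/funext => x; rewrite iterSr.
Qed.

Lemma mean_cvg_measure (F : nat -> X -> R) (U : set X) :
  measurable (U : set (borel_type X)) ->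
  (forall n, continuous (F n)) -> (forall n, unit_valued (F n)) ->
  (forall x, F n x @[n --> \oo] --> (\1_U x : R)) ->
  mean (F n) @[n --> \oo] --> fine (mu U).
Proof.
move=> mU cF F01 Fcv.
have [|||||_ _] := @dominated_convergence _ _ _ mu setT measurableT
   (fun n x => (F n x)%:E) (EFin \o \1_U) (cst 1%E).
- by move=> n; apply/measurable_EFinP; exact: continuous_measurable_borel.
- by apply/measurable_EFinP; exact: measurable_indic.
- by apply: aeW => x _; apply: cvg_EFin; [exact: nearW|exact: Fcv].
- apply: (@bounded_continuous_integrable (fun=> 1)).
  exact: bounded_continuous_cst.
- apply: aeW => x n _; rewrite lee_fin.
  by have /andP[? ?] := F01 n x; rewrite ger0_norm.
rewrite integral_indic// setIT => h.
have /fine_cvgP[_] : (\int[mu]_(x in [set: borel_type X]) (F n x)%:E)%E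
   @[n --> \oo] --> (fine (mu U))%:E.
  by rewrite fineK// fin_num_measure.
by [].
Qed.

End Mean.

(** * Lipschitz functions separate Borel probability measures *)

Section Lipschitz.
Context {R : realType} {X : metricType R}.
Implicit Types (f g : X -> R) (c : R) (U : set X) (x : X).

Lemma exists_nat_gt (a : R) : exists n : nat, a < n%:R.
Proof.
exists (Num.bound `|a|); apply: le_lt_trans (ler_norm a) _; exact: archi_boundP.
Qed.

Lemma near_mdist (x : X) (P : set X) :
  nbhs x P <-> exists2 e : R, 0 < e & forall y, mdist x y < e -> P y.
Proof.
split=> [/nbhs_ballP[e e0 eP]|[e e0 eP]].
  by exists e => // y xy; apply: eP; rewrite ballEmdist.
by apply/nbhs_ballP; exists e => // y; rewrite ballEmdist; exact: eP.
Qed.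

(* One-sided, but equivalent to the usual two-sided bound by symmetry of the distance. *)
Definition lip c f : Prop := forall x y, f x <= f y + c * mdist x y.

Lemma lip_dist c f x y : lip c f -> `|f x - f y| <= c * mdist x y.
Proof.
move=> lf; have := lf x y; have := lf y x; rewrite metric_sym => ? ?.
by rewrite ler_norml; apply/andP; split; lra.
Qed.

Lemma lip_modulus c f (e : R) : lip c f -> 0 < e ->
  exists2 d : R, 0 < d & forall x y, mdist x y < d -> `|f x - f y| <= e.
Proof.
move=> lf e0; have c0 : 0 < `|c| + 1 by rewrite ltr_wpDl.
exists (e / (`|c| + 1)); first exact: divr_gt0.
move=> x y xy; apply: le_trans (lip_dist x y lf) _.
apply: (@le_trans _ _ ((`|c| + 1) * mdist x y)).
  by rewrite ler_wpM2r ?mdist_ge0// (le_trans (ler_norm c))// lerDl.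
by move: xy; rewrite ltr_pdivlMr// mulrC => /ltW.
Qed.

Lemma lip_continuous c f : lip c f -> continuous f.
Proof.
move=> lf x; apply/cvgrPdist_le => e e0; have [d d0 dP] := lip_modulus lf e0.
by apply/near_mdist; exists d => // y; exact: dP.
Qed.

Lemma lip_min1 c f : 0 <= c -> lip c f -> lip c (fun x => Num.min 1 (f x)).
Proof.
move=> c0 lf x y; have := mulr_ge0 c0 (mdist_ge0 x y); have := lf x y.
by case: (leP 1 (f x)); case: (leP 1 (f y)); lra.
Qed.

Lemma lip_oppr c f : lip c f -> lip c (fun x => 1 - f x).
Proof. by move=> lf x y; have := lf y x; rewrite metric_sym; lra. Qed.

Lemma lip_mdist c (p : X) (a : R) : 0 <= c -> lip c (fun x => a - c * mdist x p).
Proof.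
move=> c0 x y; have := ler_wpM2l c0 (metric_triangle y x p).
by rewrite mulrDr (metric_sym y x); lra.
Qed.

(** The distance to the complement of [U], truncated at 1 so that it is finite for [U = setT] as
    well. *)
Definition inner_radius (U : set X) (x : X) : R :=
  sup [set r : R | 0 <= r <= 1 /\ forall z, mdist x z < r -> U z].

Lemma inner_radius_has_sup U x :
  has_sup [set r : R | 0 <= r <= 1 /\ forall z, mdist x z < r -> U z].
Proof.
split; last by exists 1 => r [/andP[]].
by exists 0; split; [rewrite lexx ler01|move=> z; rewrite ltNge mdist_ge0].
Qed.

Lemma inner_radius_ge U x r : 0 <= r <= 1 -> (forall z, mdist x z < r -> U z) ->
  r <= inner_radius U x.
Proof.
by move=> r01 rU; apply: sup_upper_bound => //; exact: inner_radius_has_sup.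
Qed.

Lemma inner_radius_ge0 U x : 0 <= inner_radius U x.
Proof.
by apply: inner_radius_ge => [|z]; rewrite ?lexx ?ler01// ltNge mdist_ge0.
Qed.

Lemma lip_inner_radius U : lip 1 (inner_radius U).
Proof.
move=> x y; rewrite mul1r; apply: ge_sup.
  by case: (inner_radius_has_sup U x).
move=> r [/andP[r0 r1] rU]; have [rd|dr] := leP r (mdist x y).
  by rewrite (le_trans rd)// lerDr inner_radius_ge0.
rewrite -lerBlDr; apply: inner_radius_ge.
  by have := mdist_ge0 x y => ?; apply/andP; split; lra.
by move=> z yz; apply: rU; have := metric_triangle x y z; lra.
Qed.

Lemma inner_radius_open U x : open U -> (U x <-> 0 < inner_radius U x).
Proof.
move=> oU; split=> [Ux|].
  have /near_mdist[e e0 eU] := open_nbhs_nbhs (conj oU Ux).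
  apply: (@lt_le_trans _ _ (Num.min 1 e)); first by rewrite lt_min ltr01 e0.
  apply: inner_radius_ge; first by rewrite ge_min lexx /= le_min ler01 ltW.
  by move=> z; rewrite lt_min => /andP[_]; exact: eU.
move=> /(sup_gt (inner_radius_has_sup U x).1)[r [_ rU] r0].
by apply: rU; rewrite mdistxx.
Qed.

Lemma lip_scale c (a : R) f : 0 <= a -> lip c f -> lip (a * c) (fun x => a * f x).
Proof.
move=> a0 lf x y; have := ler_wpM2l a0 (lf x y).
by rewrite mulrDr mulrA.
Qed.

End Lipschitz.

Section Separation.
Context {R : realType} {X : completeMetricType R}.
Implicit Types (mu nu : probability (borel_type X) R).

Lemma measure_eq_of_open mu nu :
  (forall U : set X, open U -> mu U = nu U) ->
  forall A : set (borel_type X), measurable A -> mu A = nu A.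
Proof.
move=> eqU A mA.
apply: (@g_sigma_algebra_measure_unique _ R (borel_type X) (@open X) _
  (fun=> setT)) => //.
- by move=> U oU; exact: open_measurable_borel.
- by move=> _; exact: openT.
- by rewrite bigcup_const.
- by move=> U V oU oV; exact: openI.
- by move=> _; rewrite [ltLHS](probability_setT mu) ltry.
Qed.

(** The functions [F n] are Lipschitz and converge pointwise to the indicator of the open set [U].
    If no Lipschitz function separated the means, the measures would agree on open sets, hence on
    Borel sets. *)
Lemma lip_separation mu nu (A : set (borel_type X)) :
  measurable A -> mu A <> nu A ->
  exists f : X -> R, [/\ unit_valued f, exists c, lip c f & mean mu f < mean nu f].
Proof.
move=> mA muA; apply: contrapT => H; apply: muA.
apply: measure_eq_of_open A mA => U oU.
pose F n x : R := Num.min 1 (n%:R * inner_radius U x).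
have F01 n : unit_valued (F n).
  move=> x; have h := inner_radius_ge0 U x.
  by rewrite /F ge_min lexx /= andbT le_min ler01 mulr_ge0.
have Flip n : lip n%:R (F n).
  apply: lip_min1 => //; rewrite -[X in lip X _]mulr1.
  by apply: lip_scale => //; exact: lip_inner_radius.
have Fcont n := lip_continuous (Flip n).
have Fmean n : mean mu (F n) = mean nu (F n).
  have bF := unit_bounded_continuous (Fcont n) (F01 n).
  apply/eqP; rewrite eq_le !leNgt; apply/andP; split; apply/negP => lt.
    (* Passing to [1 - F n] reverses an inequality that goes the wrong way. *)
    apply: H; exists (fun x => 1 - F n x); split.
    - by move=> x; have /andP[? ?] := F01 n x; apply/andP; split; lra.
    - by exists n%:R; exact: lip_oppr.
    - have mB (m : probability (borel_type X) R) :
          mean m (fun x => 1 - F n x) = 1 - mean m (F n).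
        have b1 := @bounded_continuous_cst R X 1.
        rewrite -[X in _ = X - _](mean_cst m 1) -[- mean _ _]mulN1r -meanZ//.
        rewrite -meanD//; last exact: bounded_continuousZ.
        by congr mean; apply/funext => x; rewrite mulN1r.
      by rewrite !mB; lra.
  by apply: H; exists (F n); split=> //; exists n%:R.
have Fcv x : F n x @[n --> \oo] --> (\1_U x : R).
  have [Ux|nUx] := pselect (U x).
    rewrite indicE mem_set//.
    have r0 := (inner_radius_open x oU).1 Ux.
    have [N NP] := exists_nat_gt (inner_radius U x)^-1.
    apply: cvg_near_cst; exists N => // n /= Nn.
    rewrite /F; apply/eqP; rewrite eq_le ge_min lexx /= le_min lexx /=.
    rewrite -ler_pdivrMr// div1r (le_trans (ltW NP))// ler_nat //.
  rewrite indicE memNset//.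
  have r0 : inner_radius U x = 0.
    apply/eqP; rewrite eq_le inner_radius_ge0 andbT leNgt; apply/negP.
    by move/(inner_radius_open x oU).2.
  apply: cvg_near_cst; apply: nearW => n.
  by rewrite /F r0 mulr0 min_r.
have mU := open_measurable_borel oU.
have cnu := mean_cvg_measure (mu := nu) mU Fcont F01 Fcv.
have cmu : mean nu (F n) @[n --> \oo] --> fine (mu U).
  by under eq_fun do rewrite -Fmean; exact: mean_cvg_measure.
have fin (m : probability (borel_type X) R) : m U \is a fin_num.
  by apply: fin_num_measure.
by rewrite -(fineK (fin mu)) -(fineK (fin nu)) (cvg_unique _ cmu cnu).
Qed.

End Separation.

(** * Greedy sampling of an invariant measure *)

Section Sampling.
Context {R : realType} {X : ptopologicalType} (mu : probability (borel_type X) R).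

(* Greedy choice: the next sample makes an almost non-acute angle with the current
   error vector, hence the square of the error grows at most linearly. *)
Lemma greedy_sampling (G : nat -> X -> R) (n : nat) :
  (forall j, continuous (G j)) -> (forall j, unit_valued (G j)) ->
  exists p : nat -> X, forall q,
    \sum_(j < n) (\sum_(l < q) (G j (p l) - mean mu (G j))) ^+ 2 <= q%:R * (n%:R + 2).
Proof.
move=> Gc G01; have bG j := unit_bounded_continuous (Gc j) (G01 j).
pose a j := mean mu (G j).
(* The sum has [mu]-mean 0; the slack 1 is there because the value 0 need not be reached from
   below. *)
have sel (S : nat -> R) : exists x, \sum_(j < n) S j * (G j x - a j) <= 1.
  have bF (j : 'I_n) : bounded_continuous (fun x => S j * G j x).
    exact: bounded_continuousZ.
  have [x] := exists_le_mean mu (bounded_continuous_sum (index_enum 'I_n) bF) ltr01.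
  rewrite mean_sum// => xP; exists x.
  under eq_bigr do rewrite mulrBr.
  rewrite sumrB lerBlDl (le_trans xP)// lerD2r.
  by apply: ler_sum => j _; rewrite meanZ.
have [f fP] := choice sel.
pose st := fix st q : nat -> R :=
  if q is q'.+1 then fun j => st q' j + (G j (f (st q')) - a j) else fun=> 0.
exists (fun q => f (st q)).
have stE q j : \sum_(l < q) (G j (f (st l)) - a j) = st q j.
  by elim: q => [|q IH]; [rewrite big_ord0|rewrite big_ord_recr /= IH].
move=> q; under eq_bigr do rewrite stE.
elim: q => [|q IH]; first by rewrite big1 ?mul0r// => j _; rewrite /= expr0n.
(* Each new sample adds at most [n] through the squares and at most 2 through the cross term. *)
have -> : \sum_(j < n) st q.+1 j ^+ 2 = \sum_(j < n) st q j ^+ 2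
    + 2 * (\sum_(j < n) st q j * (G j (f (st q)) - a j))
    + \sum_(j < n) (G j (f (st q)) - a j) ^+ 2.
  rewrite mulr_sumr -!big_split /=; apply: eq_bigr => j _; ring.
have := fP (st q).
have : \sum_(j < n) (G j (f (st q)) - a j) ^+ 2 <= n%:R.
  rewrite -[X in _ <= X%:R]card_ord -sumr_const; apply: ler_sum => j _.
  rewrite -real_normK ?num_real// expr_le1// ler_norml.
  have /andP[? ?] := G01 j (f (st q)); have /andP[? ?] := mean_unit mu (Gc j) (G01 j).
  by rewrite /a; apply/andP; split; lra.
by rewrite -natr1 mulrDl mul1r; lra.
Qed.

(** Greedy sampling is applied to averages over blocks of length [m], whose means are those of [h j]
    by invariance. The square-root error is relaxed to a form linear in [q], with the same [p] for
    every [eta]. *)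
Lemma greedy_sampling_bsum (T : X -> X) (h : nat -> X -> R) (n m : nat) :
  continuous T -> invariant_measure T mu -> (0 < m)%N ->
  (forall j, continuous (h j)) -> (forall j, unit_valued (h j)) ->
  exists p : nat -> X, forall (eta : R) q j, 0 < eta -> (j < n)%N ->
    `|\sum_(l < q) (bsum T (h j) m (p l) - m%:R * mean mu (h j))|
      <= eta * (q * m)%:R + m%:R * (n%:R + 2) / eta.
Proof.
move=> cT iT m0 hc h01; have mR : 0 < m%:R :> R by rewrite ltr0n.
have bh j := unit_bounded_continuous (hc j) (h01 j).
have bS j := bounded_continuous_bsum m cT (bh j).
pose G j x : R := m%:R^-1 * bsum T (h j) m x.
have bG j : bounded_continuous (G j) by exact: bounded_continuousZ.
have G01 j : unit_valued (G j).
  move=> x; have /andP[? ?] := bsum_unit T m x (h01 j).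
  by rewrite /G mulr_ge0 ?invr_ge0 ?(ltW mR)//= mulrC ler_pdivrMr// mul1r.
have [p pP] := greedy_sampling n (fun j => (bG j).1) G01.
exists p => eta q j eta0 jn.
have mG : mean mu (G j) = mean mu (h j).
  by rewrite /G meanZ// mean_bsum// mulKf// lt0r_neq0.
pose s := \sum_(l < q) (G j (p l) - mean mu (G j)).
have -> : \sum_(l < q) (bsum T (h j) m (p l) - m%:R * mean mu (h j)) = m%:R * s.
  rewrite /s mulr_sumr; apply: eq_bigr => l _.
  by rewrite mulrBr mG /G mulVKf// lt0r_neq0.
have s2 : s ^+ 2 <= q%:R * (n%:R + 2).
  apply: le_trans (pP q); rewrite (bigD1 (Ordinal jn)) //= lerDl.
  by apply: sumr_ge0 => i _; exact: sqr_ge0.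
have sb : `|s| <= eta * q%:R + (n%:R + 2) / eta.
  have r0 : 0 <= eta * q%:R + (n%:R + 2) / eta.
    apply: addr_ge0; first by apply: mulr_ge0 => //; exact: ltW.
    by apply: divr_ge0; [exact: addr_ge0|exact: ltW].
  rewrite -(ler_pXn2r (n := 2)) ?nnegrE// real_normK ?num_real// (le_trans s2)//.
  have -> : q%:R * (n%:R + 2) = (eta * q%:R) * ((n%:R + 2) / eta) :> R.
    by field; exact: lt0r_neq0.
  have : 0 <= eta * q%:R by apply: mulr_ge0 => //; exact: ltW.
  have : 0 <= (n%:R + 2) / eta :> R by apply: divr_ge0; [exact: addr_ge0|exact: ltW].
  by move: (eta * _) (_ / eta) => u v v0 u0; nra.
rewrite normrM ger0_norm ?(ltW mR)// natrM.
have := ler_wpM2l (ltW mR) sb; rewrite mulrDr => /le_trans; apply.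
by rewrite le_eqVlt; apply/orP; left; apply/eqP; field; exact: lt0r_neq0.
Qed.

End Sampling.

(** * One stage of the construction *)

Lemma ler_norm_step (R : realType) (x w a b : R) :
  `|x - w| <= a -> `|w| <= b -> `|x| <= a + b.
Proof.
by move=> xw wb; rewrite -[x](subrK w) (le_trans (ler_normD _ _))// lerD.
Qed.

Section Step.
Context {R : realType} {X : completeMetricType R} (T : X -> X).
Context (mu nu : probability (borel_type X) R) (h : nat -> X -> R).
Hypotheses (cT : continuous T) (saps : strong_approximate_product_structure T).
Hypotheses (imu : invariant_measure T mu) (inu : invariant_measure T nu).
Hypotheses (h01 : forall j, unit_valued (h j)) (hlip : forall j, exists c, lip c (h j)).
Hypothesis h0_sep : mean mu (h 0%N) < mean nu (h 0%N).

Definition dev (j k : nat) (y : X) : R := bsum T (h j) k y - k%:R * mean mu (h j).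

Let hcont j : continuous (h j).
Proof. by have [c] := hlip j; exact: lip_continuous. Qed.

Lemma dev_addn j k l y : `|dev j (k + l) y - dev j k y| <= l%:R.
Proof.
rewrite /dev bsumD natrD mulrDl.
have /andP[? ?] := bsum_unit T l (iter k T y) (h01 j).
have /andP[a0 a1] := mean_unit mu (@hcont j) (h01 j).
have := mulr_ge0 (ler0n R l) a0; have := ler_wpM2l (ler0n R l) a1; rewrite mulr1.
by rewrite ler_norml => ? ?; apply/andP; split; lra.
Qed.

Lemma dev_le j k y : `|dev j k y| <= k%:R.
Proof.
by have := dev_addn j 0 k y; rewrite add0n {2}/dev bsum0 mul0r !subr0.
Qed.

Lemma dev_dist j k (e : R) x y :
  (forall i, (i < k)%N -> `|h j (iter i T x) - h j (iter i T y)| <= e) ->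
  `|dev j k x - dev j k y| <= e * k%:R.
Proof.
move=> hxy; rewrite /dev (_ : _ - _ = bsum T (h j) k x - bsum T (h j) k y); last ring.
exact: bsum_dist.
Qed.

Lemma common_modulus n (e : R) : 0 < e -> exists2 d : R, 0 < d &
  forall j x y, (j <= n)%N -> mdist x y < d -> `|h j x - h j y| <= e.
Proof.
move=> e0; elim: n => [|n [d d0 dP]].
  have [c c0] := hlip 0; have [d d0 dP] := lip_modulus c0 e0.
  by exists d => // j x y; rewrite leqn0 => /eqP ->; exact: dP.
have [c c0] := hlip n.+1; have [d' d'0 d'P] := lip_modulus c0 e0.
exists (Num.min d d'); first by rewrite lt_min d0.
move=> j x y; rewrite leq_eqVlt lt_min => /orP[/eqP ->|jn] /andP[xd xd'].
  exact: d'P.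
exact: dP.
Qed.

(* A stage appends (v+1)c blocks typical for mu, followed by c blocks whose h 0
   averages are biased towards nu, where c m dominates the time t elapsed so far. *)
Lemma stage (n : nat) (e eta : R) : 0 < e -> 0 < eta ->
  exists K : nat, forall (K' : nat) y (t v : nat), (K <= t)%N ->
  exists y' (t' : nat),
    [/\ (K' <= t')%N, (t < t')%N, t%:R <= eta * t'%:R &
      forall j, (j < t)%N -> mdist (iter j T y) (iter j T y') < e] /\
    [/\ forall j k, (j <= n)%N -> (t <= k <= t')%N ->
          `|dev j k y' - dev j t y| <= (eta + v.+1%:R^-1) * k%:R,
        exists2 k, (t <= k <= t')%N & `|dev 0 k y'| <= eta * k%:R &
        ((mean nu (h 0) - mean mu (h 0)) / (2 * v.+3%:R) - eta) * t'%:R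
          <= dev 0 t' y'].
Proof.
move=> e0 eta0.
(* Each of the three deviation bounds loses [6 * r], so 16 leaves room; the minimum with 1 yields
   [r <= 1], needed for [t <= P]. *)
pose r := Num.min eta 1 / 16.
have r0 : 0 < r by rewrite /r divr_gt0// lt_min eta0 ltr01.
have r_eta : 16 * r <= eta by rewrite /r mulrC divfK// ge_min lexx.
have r_1 : 16 * r <= 1 by rewrite /r mulrC divfK// ge_min lexx orbT.
have [d d0 dP] := common_modulus n r0.
pose ep := Num.min (Num.min e d) r.
have ep0 : 0 < ep by rewrite !lt_min e0 d0 r0.
have ep_e : ep <= e by rewrite !ge_min lexx.
have ep_d : ep <= d by rewrite !ge_min lexx orbT.
have ep_r : ep <= r by rewrite !ge_min lexx orbT.
have [N NP] := trace_append saps ep0.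
pose m := maxn N 1.
have m0 : (0 < m)%N by rewrite /m leq_max orbT.
have Nm : (N <= m)%N by rewrite /m leq_maxl.
have mR : 0 < m%:R :> R by rewrite ltr0n.
have [p pP] := greedy_sampling_bsum n.+1 cT imu m0 hcont h01.
set a0 := mean mu (h 0); set b0 := mean nu (h 0).
have ab : a0 < b0 by [].
(* A block starting at [z] has average at least the midpoint of the two means; repeating it creates
   the bias. *)
have [z zP] : exists z, m%:R * ((a0 + b0) / 2) <= bsum T (h 0) m z.
  have bh := unit_bounded_continuous (@hcont 0) (h01 0).
  have g0 : 0 < m%:R * ((b0 - a0) / 2) by rewrite mulr_gt0// divr_gt0// subr_gt0.
  have [z zP] := exists_ge_mean nu (bounded_continuous_bsum m cT bh) g0.
  by exists z; move: zP; rewrite mean_bsum// -/b0; lra.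
(* A time [t >= K0] absorbs both the block length and the constant term of the greedy bound into
   [r * t]. *)
have [K0 K0P] := exists_nat_gt (m%:R / r + m%:R * (n.+1%:R + 2) / r / r : R).
exists (maxn K0 m) => K' y t v; rewrite geq_max => /andP[K0t mt].
have t0 : (0 < t)%N by exact: leq_trans m0 mt.
have Nt : (N <= t)%N by exact: leq_trans Nm mt.
have tP : m%:R / r + m%:R * (n.+1%:R + 2) / r / r <= t%:R :> R.
  by apply: le_trans (ltW K0P) _; rewrite ler_nat.
have u1 : 0 <= m%:R / r :> R by rewrite divr_ge0 ?(ltW mR) ?(ltW r0).
have u2 : 0 <= m%:R * (n.+1%:R + 2) / r / r :> R.
  by rewrite !mulr_ge0 ?invr_ge0 ?addr_ge0 ?(ltW mR) ?(ltW r0).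
have mrt : m%:R <= r * t%:R :> R by rewrite mulrC -ler_pdivrMr//; lra.
have nrt : m%:R * (n.+1%:R + 2) / r <= r * t%:R :> R.
  by rewrite [leRHS]mulrC -ler_pdivrMr//; lra.
(* From here on the past is negligible: [t <= r * P] for the length [P] of the biased part. *)
have [c0 c0P] := exists_nat_gt (t%:R / r : R).
pose c := maxn (maxn c0 K') 1.
have c1 : (0 < c)%N by rewrite /c leq_max orbT.
have K'c : (K' <= c)%N by rewrite /c !leq_max leqnn orbT.
have c0c : (c0 <= c)%N by rewrite /c !leq_max leqnn.
pose P : R := (c * m)%:R.
have cP : c%:R <= P by rewrite /P ler_nat leq_pmulr.
have trP : t%:R <= r * P.
  rewrite mulrC -ler_pdivrMr//; apply: le_trans (ltW c0P) (le_trans _ cP).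
  by rewrite ler_nat.
pose Q1 := (v.+1 * c)%N; pose Q := (Q1 + c)%N.
pose w l := if (l < Q1)%N then p l else z.
have [y' [y'y y'P]] := NP y t m Q w t0 m0 Nt Nm.
have tR : 0 < t%:R :> R by rewrite ltr0n.
have P0 : 0 < P by rewrite ltr0n muln_gt0 c1 m0.
have Q1E : (Q1 * m)%:R = v.+1%:R * P by rewrite /P -natrM mulnA.
pose W j q := \sum_(l < q) (bsum T (h j) m (w l) - m%:R * mean mu (h j)).
have main j q : (j <= n)%N -> (q <= Q)%N ->
    `|dev j (t + q * m) y' - dev j t y - W j q| <= 4 * r * (t + q * m)%:R.
  move=> jn qQ; have hw u u' : mdist u u' < ep -> `|h j u - h j u'| <= r.
    by move=> uu'; apply: dP => //; exact: lt_le_trans uu' ep_d.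
  have := y'P (h j) r (h01 j) (ltW r0) hw q qQ.
  have -> : W j q = \sum_(l < q) bsum T (h j) m (w l) - (q * m)%:R * mean mu (h j).
    by rewrite /W sumrB sumr_const card_ord natrM -[X in _ - X = _]mulr_natl mulrA.
  rewrite /dev.
  have h1 : ep * (q * m)%:R <= r * (q * m)%:R by rewrite ler_wpM2r.
  have h2 : 0 <= r * t%:R by rewrite mulr_ge0 ?(ltW r0).
  rewrite (_ : _ - _ - _ - _ = bsum T (h j) (t + q * m) y' - bsum T (h j) t y
      - \sum_(l < q) bsum T (h j) m (w l)); last by rewrite natrD mulrDl; ring.
  move=> /le_trans; apply; rewrite natrD; clear - T mu nu h cT saps imu inu h01 hlip h0_sep h1 h2; lra.
have W1 j q : (j <= n)%N -> (q <= Q1)%N -> `|W j q| <= r * (t + q * m)%:R.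
  move=> jn qQ; rewrite /W (eq_bigr (fun l : 'I_q =>
    bsum T (h j) m (p l) - m%:R * mean mu (h j))); last first.
    by move=> l _; rewrite /w (leq_trans (ltn_ord l) qQ).
  by apply: le_trans (pP r q j r0 _) _ => //; rewrite natrD [leRHS]mulrDr [leLHS]addrC lerD2r.
have W2 j q : W j (Q1 + q) = W j Q1 + q%:R * (bsum T (h j) m z - m%:R * mean mu (h j)).
  rewrite /W big_split_ord /=; congr (_ + _).
  rewrite (eq_bigr (fun=> bsum T (h j) m z - m%:R * mean mu (h j))).
    by rewrite sumr_const card_ord [RHS]mulr_natl.
  by move=> l _; rewrite /w ltnNge leq_addr.
have v1 : 0 < v.+1%:R :> R by rewrite ltr0n.
(* Within the biased part the extra deviation is at most [P], and the [mu]-typical part before it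
   already has length [v.+1 * P]. *)
have blocks j q : (j <= n)%N -> (q <= Q)%N ->
    `|dev j (t + q * m) y' - dev j t y| <= (5 * r + v.+1%:R^-1) * (t + q * m)%:R.
  move=> jn qQ.
  have [qQ1|Q1q] := leqP q Q1.
    apply: le_trans (ler_norm_step (main j q jn qQ) (W1 j q jn qQ1)) _.
    rewrite -mulrDl ler_wpM2r// (_ : 4 * r + r = 5 * r); last ring.
    by rewrite lerDl invr_ge0 ltW.
  have [q' qE] : exists q', q = (Q1 + q')%N by exists (q - Q1)%N; rewrite subnKC// ltnW.
  have q'c : (q' <= c)%N by move: qQ; rewrite qE /Q leq_add2l.
  have dz : `|W j (Q1 + q') - W j Q1| <= P.
    rewrite W2 addrAC subrr add0r normrM ger0_norm// /P natrM ler_pM ?ler_nat//.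
    exact: dev_le.
  have PA : P <= v.+1%:R^-1 * (t + (Q1 + q') * m)%:R.
    rewrite mulrC ler_pdivlMr// mulrC -Q1E ler_nat mulnDl.
    exact: leq_trans (leq_addr _ _) (leq_addl _ _).
  have WA : `|W j Q1| <= r * (t + (Q1 + q') * m)%:R.
    apply: le_trans (W1 j Q1 jn (leqnn _)) _.
    by rewrite ler_wpM2l ?(ltW r0)// ler_nat leq_add2l mulnDl leq_addr.
  have := main j q jn qQ; rewrite qE => hm.
  apply: le_trans (ler_norm_step hm (ler_norm_step dz WA)) _.
  by rewrite addrCA [leLHS]addrC [leRHS]mulrDl lerD// -mulrDl -[X in _ + X]mul1r -mulrDl natr1.
pose t' := (t + Q * m)%N.
have t'E : t'%:R = t%:R + v.+1%:R * P + P.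
  by rewrite /t' natrD /Q mulnDl natrD Q1E addrA.
have Pt' : P <= t'%:R by rewrite t'E -[leLHS]add0r lerD2r addr_ge0 ?mulr_ge0// ltW.
exists y', t'; split; split.
- rewrite (leq_trans K'c)// (leq_trans (leq_pmulr c m0))// /t' /Q mulnDl.
  exact: leq_trans (leq_addl _ _) (leq_addl _ _).
- by rewrite /t' -[X in (X < _)%N]addn0 ltn_add2l muln_gt0 m0 andbT /Q addn_gt0 c1 orbT.
- apply: le_trans trP _; apply: le_trans (ler_wpM2l (ltW r0) Pt') _.
  by rewrite ler_wpM2r//; lra.
- by move=> j jt; apply: lt_le_trans (y'y j jt) ep_e.
- move=> j k jn /andP[tk kt'].
  (* An arbitrary time is rounded down to a block end; the remainder is shorter than
     [m <= r * k]. *)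
  have [q [s [sm qQ kE]]] : exists q s, [/\ (s < m)%N, (q <= Q)%N & k = (t + q * m + s)%N].
    exists ((k - t) %/ m)%N, ((k - t) %% m)%N; split.
    - by rewrite ltn_mod.
    - rewrite -(leq_pmul2r m0) (leq_trans (leq_divM _ _))// leq_subLR; exact: kt'.
    - by rewrite -addnA -divn_eq subnKC.
  have sk : s%:R <= r * k%:R.
    apply: (@le_trans _ _ m%:R); first by rewrite ler_nat ltnW.
    by apply: le_trans mrt _; rewrite ler_wpM2l ?(ltW r0)// ler_nat.
  have v0 : 0 <= v.+1%:R^-1 :> R by rewrite invr_ge0 ltW.
  have r5 : 0 <= 5 * r by rewrite mulr_ge0// ltW.
  have bk : (5 * r + v.+1%:R^-1) * (t + q * m)%:R <= (5 * r + v.+1%:R^-1) * k%:R.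
    by rewrite ler_wpM2l ?addr_ge0// ler_nat kE leq_addr.
  have dk := le_trans (dev_addn j (t + q * m) s y') sk; rewrite -kE in dk.
  have dd : `|dev j k y' - dev j t y - (dev j (t + q * m) y' - dev j t y)| <= r * k%:R.
    by rewrite (_ : _ - (_ - _) = dev j k y' - dev j (t + q * m) y')//; ring.
  apply: le_trans (ler_norm_step dd (le_trans (blocks j q jn qQ) bk)) _.
  rewrite -mulrDl ler_wpM2r// addrA lerD2r.
  by clear - T mu nu h cT saps imu inu h01 hlip h0_sep r_eta r0; lra.
- have Q1Q : (Q1 <= Q)%N by rewrite /Q leq_addr.
  exists (t + Q1 * m)%N; first by rewrite leq_addr /t' leq_add2l leq_mul2r Q1Q orbT.
  have PA : P <= (t + Q1 * m)%:R.
    by rewrite natrD Q1E -[leLHS]add0r lerD// ?(ltW tR)// ler_peMl ?ler1n// ltW.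
  have tA : `|dev 0 t y| <= r * (t + Q1 * m)%:R.
    apply: le_trans (dev_le 0 t y) (le_trans trP _).
    by rewrite ler_wpM2l// ltW.
  have D1 := ler_norm_step (main 0 Q1 isT Q1Q) (W1 0 Q1 isT (leqnn _)).
  apply: le_trans (ler_norm_step D1 tA) _.
  rewrite -!mulrDl ler_wpM2r//.
  by clear - T mu nu h cT saps imu inu h01 hlip h0_sep r_eta r0; lra.
- have rP : r * P <= r * t'%:R by rewrite ler_wpM2l// ltW.
  have D1 := main 0 Q isT (leqnn _); rewrite -/t' /Q W2 -/a0 in D1.
  have D2 : `|W 0 Q1| <= r * t'%:R.
    apply: le_trans (W1 0 Q1 isT (leqnn _)) _.
    by rewrite ler_wpM2l ?(ltW r0)// ler_nat /t' leq_add2l leq_mul2r leq_addr orbT.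
  have D3 := le_trans (dev_le 0 t y) (le_trans trP rP).
  have bias : P * ((b0 - a0) / 2) <= c%:R * (bsum T (h 0) m z - m%:R * a0).
    rewrite /P natrM -mulrA ler_wpM2l//.
    by clear - T mu nu h cT saps imu inu h01 hlip h0_sep zP; lra.
  (* Origin of [v.+3]: the stage ends at [t' = t + v.+1 * P + P], which is at most [v.+3 * P]. *)
  have bt : (b0 - a0) / (2 * v.+3%:R) * t'%:R <= P * ((b0 - a0) / 2).
    rewrite (_ : _ * t'%:R = t'%:R / v.+3%:R * ((b0 - a0) / 2)); last first.
      have : v.+3%:R != 0 :> R by rewrite pnatr_eq0.
      by move: (v.+3%:R : R) => V V0; field.
    rewrite ler_wpM2r//; first by rewrite divr_ge0// subr_ge0 ltW.
    rewrite ler_pdivrMr ?ltr0n// t'E.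
    have -> : v.+3%:R = v.+1%:R + 2 :> R by rewrite -natrD addn2.
    have r1 : r <= 1 by clear - T mu nu h cT saps imu inu h01 hlip h0_sep r_1 r0; lra.
    have tP' : t%:R <= P by apply: le_trans trP _; rewrite ler_piMl ?(ltW P0).
    by rewrite mulrDr (mulrC P); clear - T mu nu h cT saps imu inu h01 hlip h0_sep tP'; lra.
  have et : 16 * r * t'%:R <= eta * t'%:R by rewrite ler_wpM2r.
  have rt : 0 <= r * t'%:R by rewrite mulr_ge0// ltW.
  rewrite mulrBl; move: D1 D2 D3.
  rewrite !ler_norml => /andP[D1 _] /andP[D2 _] /andP[D3 _].
  move: (dev 0 t' y') (dev 0 t y) (W 0 Q1) D1 D2 D3 => x1 x2 x3 D1 D2 D3.
  move: (c%:R * _) bias D1 => x4 bias D1.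
  move: (_ / (2 * _) * _) bt => x5 bt; rewrite -mulrA in et.
  rewrite -mulrA in D1; move: (r * t'%:R) (eta * t'%:R) D1 D2 D3 et rt => x6 x7 D1 D2 D3 et rt.
  by clear - T mu nu h cT saps imu inu h01 hlip h0_sep bias D1 bt D2 D3 et rt; lra.
Qed.

End Step.

(** * The continuous reduction from Baire space *)

Section Reduction.
Context {R : realType} {X : completeMetricType R} (T : X -> X).
Context (mu nu : probability (borel_type X) R) (h : nat -> X -> R).
Hypotheses (cT : continuous T) (saps : strong_approximate_product_structure T).
Hypotheses (imu : invariant_measure T mu) (inu : invariant_measure T nu).
Hypotheses (h01 : forall j, unit_valued (h j)) (hlip : forall j, exists c, lip c (h j)).
Hypothesis h0_sep : mean mu (h 0%N) < mean nu (h 0%N).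

Local Notation dev := (dev T mu h).

Lemma avg_dev j k y : (0 < k)%N ->
  birkhoff_avg T (h j) k y - mean mu (h j) = dev j k y / k%:R.
Proof.
move=> k0; have k0' : k%:R != 0 :> R by rewrite pnatr_eq0 -lt0n.
by rewrite /birkhoff_avg /dev /bsum; field.
Qed.

Lemma harmonic_small (e : R) : 0 < e ->
  exists n, forall i, (n <= i)%N -> i.+1%:R^-1 < e.
Proof.
move=> e0; have [n nP] := exists_nat_gt e^-1; exists n => i ni.
rewrite invf_plt ?posrE//; apply: lt_le_trans nP _.
by rewrite ler_nat ltnW.
Qed.

Let B v : R := (mean nu (h 0) - mean mu (h 0)) / (2 * v.+3%:R).

(** Iterates [stage] with parameter [a i] at step [i]. Since [y a i] uses only the entries below
    [i], and [lim_y a] is within [d i] of it, the limit depends continuously on [a]. *)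
Lemma construction : exists (d : nat -> R) (y : (nat -> nat) -> nat -> X)
    (t : (nat -> nat) -> nat -> nat) (lim_y : (nat -> nat) -> X),
  [/\ forall i, 0 < d i <= i.+1%:R^-1,
      forall a b i, agree i a b -> y a i = y b i,
      forall a i, (i < t a i)%N /\ (t a i < t a i.+1)%N,
      forall a i, mdist (y a i) (lim_y a) < d i &
      forall a i j k, (j <= i)%N -> (k <= t a i)%N ->
        `|dev j k (lim_y a) - dev j k (y a i)| <= i.+1%:R^-1 * k%:R] /\
  [/\ forall a i, (t a i)%:R <= i.+1%:R^-1 * (t a i.+1)%:R :> R,
      forall a i j k, (j <= i)%N -> (t a i <= k <= t a i.+1)%N ->
        `|dev j k (y a i.+1) - dev j (t a i) (y a i)|
           <= (i.+1%:R^-1 + (a i).+1%:R^-1) * k%:R,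
      forall a i, exists2 k, (t a i <= k <= t a i.+1)%N &
        `|dev 0 k (y a i.+1)| <= i.+1%:R^-1 * k%:R &
      forall a i, (B (a i) - i.+1%:R^-1) * (t a i.+1)%:R
          <= dev 0 (t a i.+1) (y a i.+1)].
Proof.
have eta0 i : 0 < i.+1%:R^-1 :> R by rewrite invr_gt0 ltr0n.
have mod_ i : exists d : R, 0 < d /\
    forall j x y, (j <= i)%N -> mdist x y < d -> `|h j x - h j y| <= i.+1%:R^-1.
  by have [d d0 dP] := common_modulus hlip i (eta0 i); exists d.
have [dl dlP] := choice mod_.
have dl0 i : 0 < dl i by case: (dlP i).
pose E i := Num.min (dl i / 4) (i.+1%:R^-1 / 4).
have E0 i : 0 < E i by rewrite lt_min !divr_gt0.
(* Halving bounds the total tracing error from step [i] on by [2 * e i]; [E i] keeps this below the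
   modulus of the first functions. *)
pose e := fix e i : R := if i is i'.+1 then Num.min (e i' / 2) (E i) else E 0.
have e0 i : 0 < e i.
  by elim: i => [|i IH]; [exact: E0|rewrite /= lt_min E0 andbT divr_gt0].
have eS i : e i.+1 <= e i / 2 by rewrite /= ge_min lexx.
have eE i : e i <= E i by case: i => [|i] //=; rewrite ge_min lexx orbT.
have e_dl i : 4 * e i <= dl i.
  by rewrite mulrC -ler_pdivlMr// (le_trans (eE i))// ge_min lexx.
have e_eta i : 4 * e i <= i.+1%:R^-1.
  by rewrite mulrC -ler_pdivlMr// (le_trans (eE i))// ge_min lexx orbT.
have [K KP] := choice (fun i => stage cT saps imu inu h01 hlip h0_sep i (e0 i) (eta0 i)).
pose good (i : nat) (s : X * nat) (v : nat) (s' : X * nat) :=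
    [/\ (K i.+1 <= s'.2)%N, (s.2 < s'.2)%N, s.2%:R <= i.+1%:R^-1 * s'.2%:R :> R &
      forall j, (j < s.2)%N -> mdist (iter j T s.1) (iter j T s'.1) < e i] /\
    [/\ forall j k, (j <= i)%N -> (s.2 <= k <= s'.2)%N ->
          `|dev j k s'.1 - dev j s.2 s.1| <= (i.+1%:R^-1 + v.+1%:R^-1) * k%:R,
        exists2 k, (s.2 <= k <= s'.2)%N & `|dev 0 k s'.1| <= i.+1%:R^-1 * k%:R &
        (B v - i.+1%:R^-1) * s'.2%:R <= dev 0 s'.2 s'.1].
have nxt (q : nat * (X * nat) * nat) :
    exists s', (K q.1.1 <= q.1.2.2)%N -> good q.1.1 q.1.2 q.2 s'.
  case: q => [[i [y t]] v] /=; have [Kt|] := leqP (K i) t; last by exists (y, t).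
  by have [y' [t' P]] := KP i (K i.+1) y t v Kt; exists (y', t').
have [F FP] := choice nxt.
(* The starting point is arbitrary; its time is large enough for the first stage, and positive. *)
pose st a := fix st i := if i is i'.+1 then F ((i', st i'), a i') else (point : X, (K 0).+1).
have stK a i : (K i <= (st a i).2)%N.
  elim: i => [|i IH]; first exact: leqnSn.
  by have [[]] := FP (i, st a i, a i) IH.
have stP a i : good i (st a i) (a i) (st a i.+1) := FP (i, st a i, a i) (stK a i).
have tS a i : ((st a i).2 < (st a i.+1).2)%N by have [[]] := stP a i.
have t_gt a i : (i < (st a i).2)%N.
  by elim: i => [|i IH] //; exact: leq_ltn_trans IH (tS a i).
have t_mono a i d : ((st a i).2 <= (st a (i + d)%N).2)%N.
  elim: d => [|d IH]; first by rewrite addn0.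
  by rewrite addnS (leq_trans IH)// ltnW.
(* Telescoping form of the geometric sum: [e i <= 2 * (e i - e i.+1)]. *)
have close a i d j : (j < (st a i).2)%N ->
    mdist (iter j T (st a i).1) (iter j T (st a (i + d)%N).1) <= 2 * (e i - e (i + d)%N).
  move=> jt; elim: d => [|d IH]; first by rewrite addn0 mdistxx subrr mulr0.
  have [[_ _ _ c1] _] := stP a (i + d)%N; rewrite addnS.
  have := c1 j (leq_trans jt (t_mono a i d)); have := eS (i + d)%N.
  have := metric_triangle (iter j T (st a i).1) (iter j T (st a (i + d)%N).1)
    (iter j T (st a (i + d)%N.+1).1).
  by move: IH => /=; lra.
have lims a : exists y : X, (fun i => (st a i).1) @ \oo --> y.
  apply/cvg_ex; apply: cauchy_cvg; apply: cauchy_exP => r r0.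
  have [n nP] := harmonic_small r0.
  exists (st a n).1; exists n => // i /= ni.
  have small : 2 * (e n - e i) < r.
    move: (nP n (leqnn n)) (e0 i) (e_eta n) (e0 n).
    by move: (n.+1%:R^-1 : R) (e n) (e i) => x u v; lra.
  rewrite ballEmdist /=; apply: le_lt_trans small.
  have := close a n (i - n)%N 0%N (leq_trans (ltn0Sn n) (t_gt a n)).
  by rewrite /= subnKC.
have [ly lyP] := choice lims.
have lim_close a i j : (j < (st a i).2)%N ->
    mdist (iter j T (st a i).1) (iter j T (ly a)) <= 2 * e i.
  move=> jt; apply/ler_addgt0Pr => r r0.
  have cj : (fun n => iter j T (st a n).1) @ \oo --> iter j T (ly a).
    by apply: (cvg_comp _ _ (lyP a)); exact: continuous_iter.
  have [n _ nP] := metricType_numDomainType.cvgr_dist_lt cj r0.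
  have := nP (i + n)%N (leq_addl _ _); have := close a i n j jt.
  have := metric_triangle (iter j T (st a i).1) (iter j T (st a (i + n)%N).1) (iter j T (ly a)).
  rewrite [X in _ -> _ -> X < r -> _]metric_sym.
  by have := e0 (i + n)%N; move=> /= ? ? ? ?; lra.
exists (fun i => 4 * e i), (fun a i => (st a i).1), (fun a i => (st a i).2), ly.
split; split.
- by move=> i; rewrite e_eta andbT mulr_gt0.
- move=> a b i ab; congr (_.1); elim: i ab => // i IH ab /=.
  by rewrite IH ?ab// => k ki; apply: ab; exact: ltnW.
- by move=> a i; split; [exact: t_gt|exact: tS].
- move=> a i; have := lim_close a i 0%N (leq_trans (ltn0Sn i) (t_gt a i)).
  by have := e0 i => /= ? ?; lra.
- move=> a i j k ji kt; apply: dev_dist => l lk; rewrite distrC.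
  have [_ dP] := dlP i; apply: dP => //.
  apply: le_lt_trans (lim_close a i l (leq_trans lk kt)) _.
  by have := e0 i; have := e_dl i; lra.
- by move=> a i; have [[]] := stP a i.
- by move=> a i; have [_ []] := stP a i.
- by move=> a i; have [_ []] := stP a i.
- by move=> a i; have [_ []] := stP a i.
Qed.

Lemma reduction : exists Y : (nat -> nat) -> X,
  [/\ forall a (e : R), 0 < e -> exists n, forall b, agree n a b -> mdist (Y a) (Y b) < e,
      forall a, to_infinity a -> forall j,
        birkhoff_avg T (h j) k (Y a) @[k --> \oo] --> mean mu (h j) &
      forall a v, (forall n, exists2 i, (n <= i)%N & a i = v) ->
        ~ cvg (birkhoff_avg T (h 0) k (Y a) @[k --> \oo])].
Proof.
have [d [y [t [Y [[dP yP tP Yd Ydev] [tt tdev tmid tend]]]]]] := construction.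
have eta0 i : 0 < i.+1%:R^-1 :> R by rewrite invr_gt0 ltr0n.
have etaS i : i.+2%:R^-1 <= i.+1%:R^-1 :> R by rewrite lef_pV2 ?posrE ?ltr0n// ler_nat.
exists Y; split.
- move=> a e e0; have e20 : 0 < e / 2 by rewrite divr_gt0.
  have [n nP] := harmonic_small e20; exists n => b ab.
  have := Yd b n; rewrite -(yP a b n ab).
  have := Yd a n; rewrite [X in X < _]metric_sym.
  have /andP[_ /le_lt_trans/(_ (nP n (leqnn n)))] := dP n.
  have := metric_triangle (Y a) (y a n) (Y b).
  move: (mdist (Y a) _) (mdist _ (Y b)) => u w.
  by move: (mdist _ _) (d n) => u' w'; lra.
- move=> a ainf j.
  (* The deviation at the start of a stage is bounded trivially by the elapsed time, a fraction
     [i.+1%:R^-1] of the time at the end. *)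
  have dev_end i : (j <= i)%N -> `|dev j (t a i.+1) (y a i.+1)| <=
      (2 * i.+1%:R^-1 + (a i).+1%:R^-1) * (t a i.+1)%:R.
    move=> ji; have h1 := tdev a i j (t a i.+1) ji.
    have [_ /ltnW lt] := tP a i; rewrite lt leqnn in h1.
    have h2 := le_trans (dev_le T mu h01 hlip j (t a i) (y a i)) (tt a i).
    apply: le_trans (ler_norm_step (h1 isT) h2) _.
    by rewrite -mulrDl ler_wpM2r// addrAC -mulr2n mulr_natl.
  have dev_all i k : (j <= i)%N -> (t a i.+1 <= k <= t a i.+2)%N ->
      `|dev j k (Y a)| <= (4 * i.+1%:R^-1 + (a i).+1%:R^-1 + (a i.+1).+1%:R^-1) * k%:R.
    move=> ji /andP[tk kt].
    have h1 := Ydev a i.+2 j k (leq_trans ji (leq_trans (leqnSn _) (leqnSn _))) kt.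
    have h2 := tdev a i.+1 j k (leq_trans ji (leqnSn _)); rewrite tk kt in h2.
    have h3 : `|dev j (t a i.+1) (y a i.+1)| <= (2 * i.+1%:R^-1 + (a i).+1%:R^-1) * k%:R.
      apply: le_trans (dev_end i ji) _; apply: ler_wpM2l; last by rewrite ler_nat.
      by rewrite addr_ge0 ?mulr_ge0 ?(ltW (eta0 _)).
    apply: le_trans (ler_norm_step h1 (ler_norm_step (h2 isT) h3)) _.
    rewrite -!mulrDl ler_wpM2r//.
    have := etaS i; have := etaS i.+1; have := etaS i.+2.
    move: (i.+1%:R^-1 : R) (i.+2%:R^-1 : R) (i.+3%:R^-1 : R) (i.+4%:R^-1 : R) => u1 u2 u3 u4.
    by move: ((a i).+1%:R^-1 : R) ((a i.+1).+1%:R^-1 : R) => u5 u6; lra.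
  apply/cvgrPdist_le => e e0.
  have e80 : 0 < e / 8 by rewrite divr_gt0.
  have [n nP] := harmonic_small e80.
  have [N NP] := ainf n.
  pose i0 := maxn j (maxn n N).
  have small i k : (i0 <= i)%N -> (t a i.+1 <= k <= t a i.+2)%N ->
      `|dev j k (Y a)| <= e * k%:R.
    rewrite !geq_max => /and3P[ji ni Ni] tk; apply: le_trans (dev_all i k ji tk) _.
    rewrite ler_wpM2r//.
    have := nP i ni; have := nP _ (NP i Ni).
    have := nP _ (NP i.+1 (leq_trans Ni (leqnSn _))).
    move: (i.+1%:R^-1 : R) ((a i).+1%:R^-1 : R) ((a i.+1).+1%:R^-1 : R) => u1 u2 u3.
    by lra.
  exists (t a i0.+1) => // k /= tk.
  have k0 : (0 < k)%N by apply: leq_trans tk; have [+ _] := tP a i0.+1; exact: leq_trans.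
  rewrite distrC avg_dev// normrM normfV normr_nat ler_pdivrMr ?ltr0n//.
  have exi n' : (k <= t a (i0.+1 + n')%N)%N -> `|dev j k (Y a)| <= e * k%:R.
    elim: n' => [|n' IH] kt.
      rewrite addn0 in kt; apply: (small i0) => //; rewrite tk /=.
      by apply: leq_trans kt _; have [_ /ltnW] := tP a i0.+1.
    have [/IH//|/ltnW lt] := leqP k (t a (i0.+1 + n')%N).
    apply: (small (i0 + n')%N); first exact: leq_addr.
    by rewrite -addSn lt /= -addnS.
  apply: (exi k); have [+ _] := tP a (i0.+1 + k)%N; move=> /ltnW.
  by apply: leq_trans; exact: leq_addl.
- move=> a v av /cvg_ex[l /cvgrPdist_lt cl].
  have B0 : 0 < B v by rewrite divr_gt0 ?mulr_gt0 ?ltr0n// subr_gt0.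
  (* The averages at the middle and at the end of the stage differ by more than [B v / 2], yet both
     are within [B v / 8] of the supposed limit. *)
  have B80 : 0 < B v / 8 by rewrite divr_gt0.
  have [n1 _ n1P] := cl _ B80.
  have [n2 n2P] := harmonic_small B80.
  have [i] := av (maxn n1 n2); rewrite geq_max => /andP[n1i n2i] aiv.
  have [ti tSi] := tP a i.
  have [k /andP[tk kt] kdev] := tmid a i.
  have k0 : (0 < k)%N by apply: leq_trans tk; exact: leq_trans ti.
  have t0 : (0 < t a i.+1)%N by exact: leq_trans k0 kt.
  have n1k : (n1 <= k)%N by apply: leq_trans n1i (leq_trans (ltnW ti) tk).
  have := n1P k n1k; have := n1P _ (leq_trans n1k kt).
  rewrite /= !ltr_norml => /andP[l1 l2] /andP[l3 l4].
  have := avg_dev 0 (Y a) k0; have := avg_dev 0 (Y a) t0.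
  have g1 : - (2 * i.+1%:R^-1) <= dev 0 k (Y a) / k%:R.
    rewrite ler_pdivlMr ?ltr0n//.
    have := ler_norm_step (Ydev a i.+1 0 k isT kt) kdev.
    have := ler_wpM2r (ler0n R k) (etaS i).
    by rewrite ler_norml; move: (i.+1%:R^-1 : R) (i.+2%:R^-1 : R) => u w ? /andP[? _]; lra.
  have g1' : dev 0 k (Y a) / k%:R <= 2 * i.+1%:R^-1.
    rewrite ler_pdivrMr ?ltr0n//.
    have := ler_norm_step (Ydev a i.+1 0 k isT kt) kdev.
    have := ler_wpM2r (ler0n R k) (etaS i).
    by rewrite ler_norml; move: (i.+1%:R^-1 : R) (i.+2%:R^-1 : R) => u w ? /andP[_ ?]; lra.
  have g2 : B v - 2 * i.+1%:R^-1 <= dev 0 (t a i.+1) (Y a) / (t a i.+1)%:R.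
    rewrite ler_pdivlMr ?ltr0n//.
    have := tend a i; rewrite aiv.
    have := Ydev a i.+1 0 (t a i.+1) isT (leqnn _).
    have := ler_wpM2r (ler0n R (t a i.+1)) (etaS i).
    by rewrite ler_norml; move: (i.+1%:R^-1 : R) (i.+2%:R^-1 : R) => u w ? /andP[? _] ?; lra.
  move: (n2P i n2i) g1 g1' g2 l1 l2 l3 l4.
  move: (i.+1%:R^-1 : R) (dev 0 k (Y a) / k%:R) (dev 0 (t a i.+1) (Y a) / (t a i.+1)%:R) => u u1 u2.
  by move: (B v) => Bv *; lra.
Qed.

End Reduction.

(** * Elementary properties of Birkhoff averages *)

Section BirkhoffAverageLemmas.
Context {R : realType} {X : topologicalType} (T : X -> X).
Implicit Types (f g : X -> R).

Lemma avgE f k x : birkhoff_avg T f k x = k%:R^-1 * bsum T f k x.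
Proof. by []. Qed.

Lemma le_avg f g k x :
  (forall j, (j < k)%N -> f (iter j T x) <= g (iter j T x)) ->
  birkhoff_avg T f k x <= birkhoff_avg T g k x.
Proof.
move=> fg; rewrite !avgE ler_wpM2l ?invr_ge0//; apply: ler_sum => j _; exact: fg.
Qed.

Lemma eq_avg f g k x :
  (forall j, (j < k)%N -> f (iter j T x) = g (iter j T x)) ->
  birkhoff_avg T f k x = birkhoff_avg T g k x.
Proof.
by move=> fg; apply/eqP; rewrite eq_le !le_avg// => j jk; rewrite fg.
Qed.

Lemma avg_lin (a b : R) f g k x :
  birkhoff_avg T (fun y => a * f y + b * g y) k x =
  a * birkhoff_avg T f k x + b * birkhoff_avg T g k x.
Proof.
by rewrite !avgE /bsum big_split /= -!mulr_sumr mulrDr; ring.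
Qed.

Lemma avg_cst (c : R) k x : (0 < k)%N -> birkhoff_avg T (fun=> c) k x = c.
Proof.
move=> k0; rewrite avgE /bsum sumr_const card_ord -[c *+ k]mulr_natl mulKf//.
by rewrite pnatr_eq0 -lt0n.
Qed.

Lemma avg_sum (n : nat) (F : nat -> X -> R) k x :
  birkhoff_avg T (fun y => \sum_(i < n) F i y) k x =
  \sum_(i < n) birkhoff_avg T (F i) k x.
Proof.
by rewrite avgE /bsum exchange_big mulr_sumr.
Qed.

Lemma avg_bounded_continuous f k : continuous T -> bounded_continuous f ->
  continuous (birkhoff_avg T f k : X -> R).
Proof.
move=> cT bf; have [+ _] := bounded_continuousZ k%:R^-1 (bounded_continuous_bsum k cT bf).
by [].
Qed.

Lemma bounded_continuous_bounded_fun f : bounded_continuous f -> bounded_fun f.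
Proof.
move=> [_ [B fB]]; exists B; split; first exact: num_real.
by move=> M BM x _; exact: le_trans (fB x) (ltW BM).
Qed.

Lemma quasi_regular_cvg x f : quasi_regular_set R T x -> bounded_continuous f ->
  cvg (birkhoff_avg T f k x @[k --> \oo]).
Proof.
move=> Qx bf; apply: contrapT => ncv; apply: Qx; exists f => //.
by split; [case: bf|exact: bounded_continuous_bounded_fun].
Qed.

End BirkhoffAverageLemmas.

(** * A countable Lipschitz family, and tightness of orbits *)

Section TestFunctions.
Context {R : realType} {X : completeMetricType R} (c_ : nat -> X).
Hypothesis c_dense : forall (y : X) (e : R), 0 < e -> exists i, mdist y (c_ i) < e.

Lemma bigmax_seq_le (s : seq (nat * nat)) (F : nat * nat -> R) (b : R) :
  0 <= b -> (forall p, p \in s -> F p <= b) -> \big[Num.max/0]_(p <- s) F p <= b.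
Proof.
move=> b0; elim: s => [|p s IH] sb; first by rewrite big_nil.
rewrite big_cons ge_max sb ?mem_head//= IH// => q qs.
by rewrite sb// inE qs orbT.
Qed.

Lemma bigmax_seq_ge (s : seq (nat * nat)) (F : nat * nat -> R) p :
  p \in s -> F p <= \big[Num.max/0]_(p <- s) F p.
Proof.
elim: s => // q s IH; rewrite big_cons le_max inE => /orP[/eqP ->|ps].
  by rewrite lexx.
by rewrite IH ?orbT.
Qed.

Lemma bigmax_seq_ge0 (s : seq (nat * nat)) (F : nat * nat -> R) :
  0 <= \big[Num.max/0]_(p <- s) F p.
Proof.
by elim: s => [|p s IH]; rewrite ?big_nil// big_cons le_max IH orbT.
Qed.

(* A countable family, indexed by lists of codes (i, q) of a centre c_ i and
   a height q / (N + 1). *)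
Definition test_fun (s : seq (nat * nat)) (N L : nat) (y : X) : R :=
  Num.min 1 (\big[Num.max/0]_(p <- s) (p.2%:R / N.+1%:R - L%:R * mdist y (c_ p.1))).

Lemma test_fun_unit s N L : unit_valued (test_fun s N L).
Proof.
by move=> y; rewrite /test_fun ge_min lexx /= le_min ler01 bigmax_seq_ge0.
Qed.

Lemma test_fun_lip s N L : lip L%:R (test_fun s N L).
Proof.
apply: lip_min1 => // x y; have d0 : 0 <= L%:R * mdist x y by rewrite mulr_ge0 ?mdist_ge0.
apply: bigmax_seq_le => [|p ps]; first by rewrite addr_ge0 ?bigmax_seq_ge0.
apply: le_trans (lip_mdist (c_ p.1) (p.2%:R / N.+1%:R) (ler0n R L) x y) _.
rewrite lerD2r.
exact: (bigmax_seq_ge (fun p => p.2%:R / N.+1%:R - L%:R * mdist y (c_ p.1)) ps).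
Qed.

Lemma test_fun_continuous s N L : continuous (test_fun s N L).
Proof. exact: lip_continuous (@test_fun_lip s N L). Qed.

Lemma test_fun_bounded_continuous s N L : bounded_continuous (test_fun s N L).
Proof.
exact: unit_bounded_continuous (@test_fun_continuous s N L) (@test_fun_unit s N L).
Qed.

(* Equal to 1 within 1 / L of the first M centres, to 0 farther than 2 / L from them. *)
Definition cover (L M : nat) : X -> R := test_fun [seq (l, 2) | l <- iota 0 M] 0 L.

Lemma mem_cover_seq l M : (l, 2)%N \in [seq (l, 2)%N | l <- iota 0 M] = (l < M)%N.
Proof.
apply/mapP/idP => [[l' + [->]]|lM]; first by rewrite mem_iota.
by exists l => //; rewrite mem_iota.
Qed.

Lemma cover_one L M l y : (l < M)%N -> L%:R * mdist y (c_ l) <= 1 -> cover L M y = 1.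
Proof.
move=> lM ly; apply/eqP; rewrite eq_le /cover /test_fun ge_min lexx /= le_min lexx /=.
rewrite -mem_cover_seq in lM.
apply: le_trans (bigmax_seq_ge (fun p => p.2%:R / 1 - L%:R * mdist y (c_ p.1)) lM) => /=.
by rewrite divr1; lra.
Qed.

Lemma cover_gt0 L M y : 0 < cover L M y ->
  exists2 l, (l < M)%N & L%:R * mdist y (c_ l) < 2.
Proof.
rewrite /cover /test_fun lt_min ltr01 /= => cp; apply: contrapT => H.
suff : \big[Num.max/0]_(p <- [seq (l, 2)%N | l <- iota 0 M])
   (p.2%:R / 1 - L%:R * mdist y (c_ p.1)) <= 0 by rewrite leNgt cp.
apply: bigmax_seq_le => // _ /mapP[l + ->] /=; rewrite mem_iota /= add0n => lM.
rewrite divr1 subr_le0 leNgt; apply/negP => ly; apply: H; by exists l.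
Qed.

Lemma cover_mono L M M' y : (M <= M')%N -> cover L M y <= cover L M' y.
Proof.
move=> MM'; rewrite /cover /test_fun le_min ge_min lexx /= ge_min.
apply/orP; right; apply: bigmax_seq_le; first exact: bigmax_seq_ge0.
move=> _ /mapP[l + ->] /=; rewrite mem_iota /= add0n => lM.
apply: (@bigmax_seq_ge _ (fun p => p.2%:R / 1 - L%:R * mdist y (c_ p.1)) (l, 2)%N).
by rewrite mem_cover_seq (leq_trans lM).
Qed.

Lemma cover_local L y : exists M, exists2 e : R, 0 < e &
  forall z, mdist y z < e -> forall M', (M <= M')%N -> cover L M' z = 1.
Proof.
(* [L.+1] instead of [L] includes the case [L = 0]. *)
pose e : R := (2 * L.+1%:R)^-1.
have e0 : 0 < e by rewrite invr_gt0 mulr_gt0.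
have [l ly] := c_dense y e0.
exists l.+1, e => // z yz M' lM'; apply: (@cover_one L M' l z) => //.
have zl : mdist z (c_ l) <= 2 * e.
  by have := metric_triangle z y (c_ l); rewrite (metric_sym z y); lra.
apply: le_trans (ler_wpM2l (ler0n R L) zl) _.
have L0 : 0 < L.+1%:R :> R by rewrite ltr0n.
rewrite (_ : 2 * e = L.+1%:R^-1) ?ler_pdivrMr ?mul1r ?ler_nat//.
by rewrite /e invfM mulrA divff ?mul1r// pnatr_eq0.
Qed.

Lemma cover_orbit (T : X -> X) L x k : exists M, forall M' j,
  (M <= M')%N -> (j < k)%N -> cover L M' (iter j T x) = 1.
Proof.
elim: k => [|k [M MP]]; first by exists 0.
have [M2 [e e0 eP]] := cover_local L (iter k T x).
exists (maxn M M2) => M' j; rewrite geq_max => /andP[MM' M2M'].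
rewrite ltnS leq_eqVlt => /orP[/eqP ->|]; last exact: MP.
by apply: eP => //; rewrite mdistxx.
Qed.

(** Uniform tightness of the empirical measures of the orbit, by total boundedness at each scale.
    Continuous covers in place of indicators make the condition closed in [x] once [L], [e] and [M]
    are fixed (for continuous [T]). *)
Definition tight_orbit (T : X -> X) (x : X) : Prop :=
  forall L (e : R), 0 < e -> exists M, forall k, (0 < k)%N ->
    1 - e <= birkhoff_avg T (cover L M) k x.

(** The finitely many early iterates are absorbed by enlarging the cover. *)
Lemma eventually_tight_orbit (T : X -> X) x :
  (forall L (e : R), 0 < e -> exists M n, forall k, (n <= k)%N ->
    1 - e <= birkhoff_avg T (cover L M) k x) -> tight_orbit T x.
Proof.
move=> ev L e e0; have [M [n MP]] := ev L e e0.
have [M2 M2P] := cover_orbit T L x n.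
exists (maxn M M2) => k k0; have [nk|kn] := leqP n k.
  apply: le_trans (MP k nk) _; apply: le_avg => j _; apply: cover_mono.
  exact: leq_maxl.
rewrite (@eq_avg _ _ _ _ (fun=> 1)) ?avg_cst ?gerBl ?(ltW e0)// => j jk.
by apply: M2P; [exact: leq_maxr|exact: ltn_trans jk kn].
Qed.

End TestFunctions.

(** * Quasi-regular points have tight orbits *)

Section GlidingHump.
Context {R : realType} {X : completeMetricType R} (T : X -> X) (c_ : nat -> X).
Hypothesis c_dense : forall (y : X) (e : R), 0 < e -> exists i, mdist y (c_ i) < e.

Local Notation cover := (cover c_).

Section AlternatingCover.
Variables (L : nat) (M : nat -> nat).
Hypothesis M_incr : forall i, (M i < M i.+1)%N.
Local Notation u i := (cover L (M i)).

Definition alternating (n : nat) (y : X) : R :=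
  \sum_(i < n) (u (2 * i).+1 y - u (2 * i) y).

Let M_ge i : (i <= M i)%N.
Proof. by elim: i => // i IH; exact: leq_ltn_trans IH (M_incr i). Qed.

Let u_mono i y : u i y <= u i.+1 y.
Proof. by apply: cover_mono; exact: ltnW. Qed.

Lemma alternating_bounds n y : 0 <= alternating n y <= u (2 * n) y - u 0 y.
Proof.
elim: n => [|n IH]; first by rewrite /alternating big_ord0 muln0 subrr lexx.
rewrite /alternating big_ord_recr /= -/(alternating n y).
have := u_mono (2 * n) y; have := u_mono (2 * n).+1 y.
rewrite (_ : 2 * n.+1 = (2 * n).+2)%N; last by rewrite mulnS.
by move: IH => /andP[? ?] ? ?; apply/andP; split; lra.
Qed.

Lemma alternating_stationary n y : u (2 * n) y = 1 ->
  forall m, (n <= m)%N -> alternating m y = alternating n y.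
Proof.
move=> un; have one k : (2 * n <= k)%N -> u k y = 1.
  move=> nk; apply/eqP; rewrite eq_le.
  have /andP[_ ->] := @test_fun_unit R X c_ [seq (l, 2)%N | l <- iota 0 (M k)] 0 L y.
  rewrite -un /=; elim: k nk => [|k IH]; first by rewrite leqn0 => /eqP ->; rewrite lexx.
  rewrite leq_eqVlt => /orP[/eqP ->|]; first by rewrite lexx.
  rewrite ltnS => /IH /le_trans; apply.
  exact: u_mono.
move=> m nm; rewrite -(subnKC nm); elim: (m - n)%N => [|d IH]; first by rewrite addn0.
rewrite addnS /alternating big_ord_recr /= -/(alternating _ y) IH !one ?subrr ?addr0//.
  by rewrite leq_mul2l leq_addr.
by rewrite (leq_trans _ (leqnSn _))// leq_mul2l leq_addr.
Qed.

(** Each point has a neighbourhood on which all late covers equal 1, so the infinite alternating sum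
    is locally finite, hence continuous. *)
Lemma alternating_limit : exists f : X -> R, [/\ continuous f, unit_valued f &
  forall n y, u (2 * n) y = 1 -> f y = alternating n y].
Proof.
have loc y : exists n, exists e : R, 0 < e /\
    forall z, mdist y z < e -> u (2 * n) z = 1.
  have [m [e e0 eP]] := cover_local c_dense L y.
  exists m, e; split=> // z yz; apply: eP => //.
  apply: leq_trans (M_ge _); by rewrite mul2n -addnn leq_addr.
have [N NP] := choice loc.
have uN y : u (2 * N y) y = 1.
  by have [e [e0]] := NP y; apply; rewrite mdistxx.
pose f y := alternating (N y) y.
have fE n y : u (2 * n) y = 1 -> f y = alternating n y.
  move=> un; have [nN|/ltnW Nn] := leqP n (N y); first exact: alternating_stationary.
  by apply/esym/alternating_stationary.
have altc n : continuous (alternating n).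
  have [+ _] : bounded_continuous (alternating n); last by [].
  apply: bounded_continuous_sum => i.
  rewrite (_ : (fun _ => _) = fun x => u (2 * i).+1 x + -1 * u (2 * i) x); last first.
    by apply/funext => x; rewrite mulN1r.
  apply: bounded_continuousD; first exact: test_fun_bounded_continuous.
  by apply: bounded_continuousZ; exact: test_fun_bounded_continuous.
exists f; split=> //.
- move=> y; apply/cvgrPdist_lt => r r0.
  have [e [e0 eP]] := NP y.
  have /cvgrPdist_lt/(_ r r0)/near_mdist[e' e'0 e'P] := altc (N y) y.
  apply/near_mdist; exists (Num.min e e'); first by rewrite lt_min e0.
  move=> z; rewrite lt_min => /andP[ze ze'].
  by rewrite (fE (N y) z (eP z ze)) {1}/f; exact: e'P.
- move=> y; have /andP[f0 f1] := alternating_bounds (N y) y.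
  have /andP[? _] := @test_fun_unit R X c_ [seq (l, 2)%N | l <- iota 0 (M 0)] 0 L y.
  rewrite /f f0 /= (le_trans f1)// uN.
  by rewrite gerBl.
Qed.

End AlternatingCover.

(* If a positive proportion of the orbit escaped every cover, it would do so in
   successive annuli; summing every other annulus gives an oscillating average. *)
Lemma quasi_regular_tight x : quasi_regular_set R T x -> tight_orbit c_ T x.
Proof.
move=> Qx; apply: (eventually_tight_orbit c_dense) => L.
pose A M k := birkhoff_avg T (cover L M) k x.
have cvgA M : exists l : R, A M k @[k --> \oo] --> l.
  have [|l lP] := (cvg_ex _).1 (@quasi_regular_cvg _ _ T x (cover L M) Qx _).
    exact: test_fun_bounded_continuous.
  by exists l.
have [l lP] := choice cvgA.
have near_l M (e : R) : 0 < e -> exists n, forall k, (n <= k)%N -> `|l M - A M k| < e.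
  by move=> e0; have /cvgrPdist_lt/(_ e e0)[n _ nP] := lP M; exists n.
move=> e e0; apply: contrapT => H.
have l_le M : l M <= 1 - e.
  rewrite leNgt; apply/negP => lM; apply: H; exists M.
  have d0 : 0 < l M - (1 - e) by rewrite subr_gt0.
  have [n nP] := near_l M _ d0; exists n => k nk.
  by have := nP k nk; rewrite /A ltr_norml => /andP[? ?]; lra.
pose ls := sup (range l).
have ls_sup : has_sup (range l).
  by split; [exists (l 0); exists 0|exists (1 - e) => _ [M _ <-]].
have l_ls M : l M <= ls by apply: sup_upper_bound => //; exists M.
have ls_le : ls <= 1 - e by apply: ge_sup; [case: ls_sup|move=> _ [M _ <-]].
pose h := e / 8; have h0 : 0 < h by rewrite divr_gt0.
have eh : e = 8 * h by rewrite /h mulrC divfK.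
have [_ [M0 _ <-] M0P] := sup_adherent h0 ls_sup.
(* At time [q.1] a proportion of at least [7 * h] escapes the cover [M], while the cover [M0] has
   almost its full limiting mass; the next cover contains the whole orbit up to then. *)
have nxt M : exists q : nat * nat, [/\ (M < q.2)%N, (M < q.1)%N, A M q.1 <= ls + h,
    ls - 2 * h <= A M0 q.1 &
    forall M' j, (q.2 <= M')%N -> (j < q.1)%N -> cover L M' (iter j T x) = 1].
  have [n nP] := near_l M h h0; have [n0 n0P] := near_l M0 h h0.
  pose k := maxn (maxn n n0) M.+1.
  have [M2 M2P] := cover_orbit c_dense T L x k.
  exists (k, maxn M2 M.+1); split=> /=.
  - by rewrite leq_max leqnn orbT.
  - by rewrite /k leq_max leqnn orbT.
  - have nk : (n <= k)%N by rewrite /k !leq_max leqnn.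
    by have := l_ls M; have := nP k nk; rewrite ltr_norml => /andP[? ?] ?; lra.
  - have nk : (n0 <= k)%N by rewrite /k !leq_max leqnn orbT.
    by have := n0P k nk; rewrite ltr_norml => /andP[? ?]; rewrite -/ls in M0P; lra.
  - by move=> M' j; rewrite geq_max => /andP[? _]; exact: M2P.
have [q qP] := choice nxt.
pose M := fix M i := if i is i'.+1 then (q (M i')).2 else M0.
pose k i := (q (M i)).1.
have M_incr i : (M i < M i.+1)%N by have [] := qP (M i).
have M_ge i : (i <= M i)%N by elim: i => // i IH; exact: leq_ltn_trans IH (M_incr i).
have k_ge i : (i < k i)%N.
  by have [_ + _ _ _] := qP (M i); exact: leq_ltn_trans (M_ge i).
have M_mono i d : (M i <= M (i + d)%N)%N.
  by elim: d => [|d IH]; rewrite ?addn0// addnS (leq_trans IH)// ltnW.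
have covered i d j : (j < k i)%N -> cover L (M (i.+1 + d)%N) (iter j T x) = 1.
  by move=> jk; have [_ _ _ _ cov] := qP (M i); apply: cov => //; exact: (M_mono i.+1).
have [f [fc f01 fE]] := alternating_limit L M_incr.
have /cvg_ex[lf /cvgrPdist_lt/(_ h h0)[n _ nP]] :
    cvg (birkhoff_avg T f k x @[k --> \oo]).
  by apply: quasi_regular_cvg => //; exact: unit_bounded_continuous.
have e2 : ((2 * n).+2 = 2 * n.+1)%N by rewrite mulnS.
(* At even indices the escaping mass lies in an annulus that [f] counts; at odd ones in an annulus
   that it omits, and what it counts is at most the mass between the covers [M 0] and
   [M (2 * n).+1]. *)
have even_large : 7 * h <= birkhoff_avg T f (k (2 * n)%N) x.
  have [_ _ A1 _ _] := qP (M (2 * n)%N).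
  apply: (@le_trans _ _ (birkhoff_avg T (fun y => 1 * 1 + -1 * cover L (M (2 * n)%N) y)
    (k (2 * n)%N) x)).
    rewrite avg_lin avg_cst; last exact: leq_ltn_trans (leq0n _) (k_ge _).
    by move: A1; rewrite /A -/(k _); lra.
  apply: le_avg => j jk.
  have := covered (2 * n)%N 1%N j jk; rewrite addn1 e2 => /fE ->.
  rewrite /alternating big_ord_recr /= -/(alternating L M n _).
  have /andP[? _] := alternating_bounds L M_incr n (iter j T x).
  have := covered (2 * n)%N 0%N j jk; rewrite addn0 => ->; lra.
have odd_small : birkhoff_avg T f (k (2 * n).+1) x <= 3 * h.
  have [_ _ A1 A2 _] := qP (M (2 * n).+1).
  apply: (@le_trans _ _ (birkhoff_avg T (fun y => 1 * cover L (M (2 * n).+1) y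
     + -1 * cover L (M 0) y) (k (2 * n).+1) x)).
    apply: le_avg => j jk.
    have := covered (2 * n).+1 0%N j jk; rewrite addn0 e2 => /fE ->.
    rewrite /alternating big_ord_recr /= -/(alternating L M n _).
    have /andP[_ ?] := alternating_bounds L M_incr n (iter j T x).
    by rewrite /= in jk *; lra.
  by rewrite avg_lin; move: A1 A2; rewrite /A -/(k _) /=; lra.
have n1 : (n <= k (2 * n)%N)%N.
  by apply: leq_trans (ltnW (k_ge _)); rewrite mul2n -addnn leq_addr.
have n2 : (n <= k (2 * n).+1)%N.
  by apply: leq_trans (ltnW (k_ge _)); rewrite mul2n -addnn (leq_trans _ (leqnSn _))// leq_addr.
have := nP _ n1; have := nP _ n2; rewrite /= !ltr_norml => /andP[? ?] /andP[? ?].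
by lra.
Qed.

End GlidingHump.

(** * Approximation of bounded continuous functions along tight orbits *)

Section Approximation.
Context {R : realType} {X : completeMetricType R} (T : X -> X) (c_ : nat -> X).

Lemma ultra_finite_cover (G : set_system X) (N : nat) (P : nat -> set X) :
  UltraFilter G -> G [set y | exists2 l, (l < N)%N & P l y] ->
  exists2 l, (l < N)%N & G (P l).
Proof.
move=> UG; elim: N => [|N IH] GN.
  have /filter_ex[y []] : G [set y | exists2 l, (l < 0)%N & P l y] by [].
  by move=> l; rewrite ltn0.
have [GP|GnP] := in_ultra_setVsetC (P N) UG; first by exists N.
have [|l lN Gl] := IH; last by exists l => //; exact: ltnW.
apply: filterS2 GN GnP => y [l lN ly] nPy; exists l => //.
by move: lN; rewrite ltnS leq_eqVlt => /orP[/eqP lE|//]; case: nPy; rewrite -lE.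
Qed.

Definition centred (M : nat -> nat) (y : X) : Prop :=
  forall m, exists2 l, (l < M m)%N & m%:R * mdist y (c_ l) < 2.

(* The set of centred points is totally bounded, hence relatively compact. *)
Lemma centred_modulus (M : nat -> nat) (f : X -> R) (e : R) :
  continuous f -> 0 < e -> exists2 d : R, 0 < d &
  forall y z, centred M y -> mdist y z < d -> `|f y - f z| <= e.
Proof.
move=> cf e0; apply: contrapT => H.
have bad n : exists yz : X * X, [/\ centred M yz.1, mdist yz.1 yz.2 < n.+1%:R^-1 &
    e < `|f yz.1 - f yz.2|].
  apply: contrapT => Hn; apply: H; exists n.+1%:R^-1; first by rewrite invr_gt0.
  move=> y z cy yz; rewrite leNgt; apply/negP => fyz; apply: Hn.
  by exists (y, z).
have [w wP] := choice bad.
(* An ultrafilter replaces a convergent subsequence: at each scale it contains one of finitely many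
   balls, so it is Cauchy. *)
have [G [UG FG]] := @ultraFilterLemma X ((fun n => (w n).1) @ \oo) _.
have small m : exists2 l, (l < M m)%N & G [set y | m%:R * mdist y (c_ l) < 2].
  apply: ultra_finite_cover; apply: FG; exists 0%N => // n _.
  by have [cw _ _] := wP n; have := cw m.
have [p Gp] : exists p : X, G --> p.
  apply/cvg_ex; apply: cauchy_cvg; apply: cauchy_exP => r r0.
  have [m mP] := exists_nat_gt (2 / r); have [l _ Gl] := small m.
  exists (c_ l); apply: filterS Gl => y /= yl.
  rewrite ballEmdist /= metric_sym.
  have m0 : 0 < m%:R :> R by apply: le_lt_trans mP; rewrite divr_ge0// ltW.
  rewrite ltr_pdivrMr// in mP.
  by rewrite -(ltr_pM2l m0); apply: lt_trans yl mP.
have e20 : 0 < e / 2 by rewrite divr_gt0.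
have /cvgrPdist_lt/(_ _ e20)/near_mdist[r r0 rP] := cf p.
have r20 : 0 < r / 2 by rewrite divr_gt0.
have [n nP] := harmonic_small r20.
have G1 : G [set y | mdist p y < r / 2] by apply: Gp; apply/near_mdist; exists (r / 2).
have G2 : G [set y | exists2 i, (n <= i)%N & y = (w i).1].
  by apply: FG; exists n => // i ni /=; exists i.
have [y [/= py [i ni yE]]] := filter_ex (@filterI _ G _ _ _ G1 G2).
have [_ wd we] := wP i; rewrite yE in py.
have := rP (w i).1; have := rP (w i).2.
have d1 := lt_trans wd (nP i ni).
have d2 := metric_triangle p (w i).1 (w i).2.
have p2 : mdist p (w i).2 < r.
  by apply: le_lt_trans d2 _; rewrite [ltRHS]splitr ltrD.
have p1 : mdist p (w i).1 < r by apply: lt_trans py _; rewrite ltr_pdivrMr// ltr_pMr// ltr1n.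
move=> /(_ p2) h2 /(_ p1) h1.
have := ler_normD (f (w i).1 - f p) (f p - f (w i).2).
rewrite subrKA [X in _ <= X + _]distrC => /le_lt_trans /(_ (ltrD h1 h2)).
by rewrite -splitr ltNge (ltW we).
Qed.

(** A maximum of cones as in McShane's extension: the cone at [c_ l] has height [f (c_ l)], rounded
    down, and is nonpositive beyond the modulus [d]. Rounding, modulus and slope contribute one [e]
    each. *)
Lemma centred_approx (M : nat -> nat) (f : X -> R) (e : R) :
  continuous f -> unit_valued f -> 0 < e ->
  exists s N L, forall y, centred M y -> `|f y - test_fun c_ s N L y| <= 3 * e.
Proof.
move=> cf f01 e0; have [d d0 dP] := centred_modulus M cf e0.
have [L LP] := exists_nat_gt d^-1.
have L0 : 0 < L%:R :> R by apply: le_lt_trans LP; rewrite invr_ge0 ltW.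
have [N NP] := exists_nat_gt e^-1.
(* At scale [2 / m] some centre is closer than [d], and its cone has dropped by at most [e]. *)
have [m mP] := exists_nat_gt (2 * L%:R / e + 2 / d).
have a1 : 0 < 2 * L%:R / e by rewrite divr_gt0// mulr_gt0.
have a2 : 0 < 2 / d by rewrite divr_gt0.
have m1 : 2 * L%:R / e < m%:R by apply: lt_trans mP; rewrite ltrDl.
have m2 : 2 / d < m%:R by apply: lt_trans mP; rewrite ltrDr.
have m0 : 0 < m%:R :> R by exact: lt_trans m2.
pose q l := Num.truncn (f (c_ l) * N.+1%:R).
have N0 : 0 < N.+1%:R :> R by rewrite ltr0n.
have Ne : N.+1%:R^-1 <= e.
  by rewrite invf_ple ?posrE// (le_trans (ltW NP))// ler_nat.
have qP l : f (c_ l) - e <= (q l)%:R / N.+1%:R <= f (c_ l).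
  have p0 : 0 <= f (c_ l) * N.+1%:R by have /andP[? _] := f01 (c_ l); rewrite mulr_ge0.
  rewrite ler_pdivrMr// truncn_le p0 andbT.
  have := truncnS_gt (f (c_ l) * N.+1%:R); rewrite -/(q l) => h.
  have : f (c_ l) < (q l).+1%:R / N.+1%:R by rewrite ltr_pdivlMr.
  by rewrite -natr1 mulrDl mul1r; move: Ne; move: (N.+1%:R^-1) => u ? ?; lra.
exists [seq (l, q l) | l <- iota 0 (M m)], N, L => y cy.
have /andP[fy0 fy1] := f01 y.
have Ld : 1 <= L%:R * d by rewrite mulrC -ler_pdivrMl// mulr1 ltW.
have up : test_fun c_ [seq (l, q l) | l <- iota 0 (M m)] N L y <= f y + e.
  rewrite /test_fun ge_min; apply/orP; right; apply: bigmax_seq_le.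
    by rewrite addr_ge0// ltW.
  move=> _ /mapP[l _ ->] /=; have /andP[_] := qP l.
  move: ((q l)%:R / N.+1%:R : R) => qN ql.
  have y0 := mdist_ge0 y (c_ l); have Ly : 0 <= L%:R * mdist y (c_ l) by rewrite mulr_ge0// ltW.
  have [yd|dy] := ltP (mdist y (c_ l)) d.
    by have := dP y (c_ l) cy yd; rewrite ler_norml => /andP[? ?]; lra.
  have := ler_wpM2l (ltW L0) dy; have /andP[_ ?] := f01 (c_ l); lra.
have low : f y - 3 * e <= test_fun c_ [seq (l, q l) | l <- iota 0 (M m)] N L y.
  rewrite /test_fun le_min; apply/andP; split; first by lra.
  have [l lM ly] := cy m.
  have yl : mdist y (c_ l) < 2 / m%:R by rewrite ltr_pdivlMr// mulrC.
  have ld : mdist y (c_ l) < d.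
    by apply: lt_trans yl _; rewrite ltr_pdivrMr// mulrC -ltr_pdivrMr.
  have Ll : L%:R * mdist y (c_ l) <= e.
    apply: le_trans (ler_wpM2l (ltW L0) (ltW yl)) _.
    by rewrite mulrA ler_pdivrMr// [leLHS]mulrC [leRHS]mulrC -ler_pdivrMr// ltW.
  have ls : (l, q l) \in [seq (l, q l) | l <- iota 0 (M m)].
    by apply/mapP; exists l => //; rewrite mem_iota.
  apply: le_trans (bigmax_seq_ge (fun p => p.2%:R / N.+1%:R - L%:R * mdist y (c_ p.1)) ls).
  have /andP[+ _] := qP l => /=; move: ((q l)%:R / N.+1%:R : R) => qN ?.
  by have := dP y (c_ l) cy ld; rewrite ler_norml => /andP[? ?]; lra.
by rewrite ler_norml; apply/andP; split; lra.
Qed.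

Lemma geometric_sum (n : nat) : \sum_(m < n) (2^-1 : R) ^+ m.+1 <= 1.
Proof.
suff -> : \sum_(m < n) (2^-1 : R) ^+ m.+1 = 1 - (2^-1) ^+ n.
  by rewrite gerBl exprn_ge0.
elim: n => [|n IH]; first by rewrite big_ord0 expr0 subrr.
by rewrite big_ord_recr /= IH exprS; field.
Qed.

(** The proportion of the orbit that fails to be centred at scale [m] is charged [e / 2 ^ m.+1]; the
    total over all scales is at most [e], on top of [3 * e] at centred points. *)
Lemma tight_approx x (f : X -> R) (e : R) :
  tight_orbit c_ T x -> continuous f -> unit_valued f -> 0 < e ->
  exists s N L, forall k, (0 < k)%N ->
    `|birkhoff_avg T f k x - birkhoff_avg T (test_fun c_ s N L) k x| <= 4 * e.
Proof.
move=> tx cf f01 e0.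
have em m : 0 < e * (2^-1) ^+ m.+1 by rewrite mulr_gt0// exprn_gt0// invr_gt0.
have [M MP] := choice (fun m => tx m _ (em m)).
have [s [N [L apx]]] := centred_approx M cf f01 e0.
exists s, N, L => k k0.
(* Only finitely many iterates matter for fixed [k], so finitely many scales detect all that are not
   centred. *)
have far : exists n, forall j, (j < k)%N -> ~ centred M (iter j T x) ->
    exists2 m, (m < n)%N & cover c_ m (M m) (iter j T x) = 0.
  elim: (k) => [|k' [n nP]]; first by exists 0%N.
  have [cc|/existsNP[m mP]] := pselect (centred M (iter k' T x)).
    exists n => j; rewrite ltnS leq_eqVlt => /orP[/eqP ->//|]; exact: nP.
  exists (maxn n m.+1) => j; rewrite ltnS leq_eqVlt => /orP[/eqP -> _|jk /(nP j jk)[m' m'n m'0]].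
    exists m; first by rewrite leq_max leqnn orbT.
    apply/eqP; rewrite eq_le.
    have /andP[-> _] := @test_fun_unit R X c_ [seq (l, 2)%N | l <- iota 0 (M m)] 0 m
      (iter k' T x).
    by rewrite andbT leNgt; apply/negP => /cover_gt0.
  by exists m' => //; rewrite leq_max m'n.
have [n nP] := far.
pose G m y : R := 1 * 1 + -1 * cover c_ m (M m) y.
(* At a point that is not centred some summand equals 1, which dominates the difference of two
   unit-valued functions. *)
pose g y := 1 * (3 * e) + 1 * \sum_(m < n) G m y.
have gP j : (j < k)%N ->
    `|f (iter j T x) - test_fun c_ s N L (iter j T x)| <= g (iter j T x).
  move=> jk; set y := iter j T x.
  have c1 m : 0 <= G m y.
    have /andP[_ ?] := @test_fun_unit R X c_ [seq (l, 2)%N | l <- iota 0 (M m)] 0 m y.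
    by rewrite /G /cover; lra.
  have [cy|ncy] := pselect (centred M y).
    have s0 : 0 <= \sum_(m < n) G m y.
      by apply: sumr_ge0 => m _.
    by apply: le_trans (apx y cy) _; rewrite /g 2!mul1r lerDl.
  have [m mn m0] := nP j jk ncy.
  have : 1 <= \sum_(m < n) G m y.
    rewrite (bigD1 (Ordinal mn)) //= {1}/G m0 mulr0 addr0 -[leLHS]mulr1 lerDl.
    by apply: sumr_ge0 => i _.
  have /andP[? ?] := f01 y; have /andP[? ?] := @test_fun_unit R X c_ s N L y.
  by rewrite /g ler_norml => ?; apply/andP; split; lra.
have gavg : birkhoff_avg T g k x <= 4 * e.
  rewrite /g avg_lin avg_cst// (avg_sum T n G) mul1r mul1r.
  apply: (@le_trans _ _ (3 * e + e * \sum_(m < n) (2^-1) ^+ m.+1)).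
    rewrite lerD2l mulr_sumr; apply: ler_sum => m _.
    by rewrite /G avg_lin avg_cst//; have := MP m k k0; lra.
  by have := ler_wpM2l (ltW e0) (geometric_sum n); lra.
have upper (u v : X -> R) :
    (forall j, (j < k)%N -> u (iter j T x) - v (iter j T x) <= g (iter j T x)) ->
    birkhoff_avg T u k x <= birkhoff_avg T v k x + 4 * e.
  move=> uv; apply: (@le_trans _ _ (birkhoff_avg T (fun y => 1 * v y + 1 * g y) k x)).
    by apply: le_avg => j /uv; rewrite !mul1r lerBlDl.
  by rewrite avg_lin !mul1r lerD2l.
rewrite ler_norml lerBlDl lerBrDl lerBlDl addrC; apply/andP; split; apply: upper => j jk;
  by have := gP j jk; rewrite ler_norml => /andP[? ?]; lra.
Qed.

Lemma tight_quasi_regular x : tight_orbit c_ T x ->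
  (forall s N L, cvg (birkhoff_avg T (test_fun c_ s N L) k x @[k --> \oo])) ->
  quasi_regular_set R T x.
Proof.
move=> tx cx [phi [cphi [B0 [_ B0P]]]]; apply.
pose B := `|B0| + 1; have B_gt0 : 0 < B by rewrite ltr_wpDl.
have phiB y : `|phi y| <= B.
  by apply: B0P => //; rewrite (le_lt_trans (ler_norm B0))// ltrDl.
pose f y := (2 * B)^-1 * phi y + 2^-1 * 1.
have fc : continuous f.
  move=> y; apply: cvgD; last exact: cvg_cst.
  by apply: cvgM; [exact: cvg_cst|exact: cphi].
have f01 : unit_valued f.
  move=> y; have := phiB y; rewrite ler_norml => /andP[p1 p2].
  rewrite /f mulr1; have B2 : 0 < 2 * B by rewrite mulr_gt0.
  have : - 2^-1 <= (2 * B)^-1 * phi y by rewrite ler_pdivlMl//; lra.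
  have : (2 * B)^-1 * phi y <= 2^-1 by rewrite ler_pdivrMl//; lra.
  by move: (_ * phi y) => u ? ?; apply/andP; split; lra.
have cvf : cvg (birkhoff_avg T f k x @[k --> \oo]).
  apply: cauchy_cvg; apply: cauchy_exP => e e0.
  have e80 : 0 < e / 8 by rewrite divr_gt0.
  have [s [N [L apx]]] := tight_approx tx fc f01 e80.
  have /cvg_ex[l /cvgrPdist_lt/(_ _ e80)[n _ nP]] := cx s N L.
  exists l; exists n.+1 => // k /= nk.
  have := nP k (ltnW nk); have := apx k (leq_trans (ltn0Sn n) nk).
  rewrite /ball /= ltr_norml ler_norml => /andP[? ?] /andP[? ?].
  by rewrite ltr_norml; apply/andP; split; lra.
have cv1 : cvg (birkhoff_avg T (fun=> 1 : R) k x @[k --> \oo]).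
  apply/cvg_ex; exists 1; apply: cvg_near_cst; exists 1%N => // k /= k0.
  exact: avg_cst.
(* Keeping the averages of 1 unevaluated makes this hold at [k = 0] too, where they vanish. *)
have phiE k : birkhoff_avg T phi k x =
    (2 * B) * birkhoff_avg T f k x - B * birkhoff_avg T (fun=> 1) k x.
  by rewrite /f avg_lin; field; exact: lt0r_neq0.
under eq_fun do rewrite phiE.
by apply: is_cvgB; apply: is_cvgM => //; exact: is_cvg_cst.
Qed.

End Approximation.

(** * Borel complexity of the quasi-regular set *)

Section BorelComplexity.
Context {X : topologicalType}.

Lemma Pi0_3_bigcap_bigcup (I : countType) (G : I -> nat -> set X) (A : set X) :
  (forall i j, closed (G i j)) -> A = \bigcap_i \bigcup_j G i j -> Pi0 3 A.
Proof.
move=> Gcl ->.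
exists (fun n => if unpickle n is Some i then ~` (\bigcup_j G i j) else set0).
  move=> n; case: (unpickle n) => [i|].
    by exists (G i); [move=> j; exact: closed_openC|rewrite setCK].
  exists (fun=> setT); first by move=> _; rewrite /= setCT; exact: open0.
  by rewrite setC0 bigcup_const.
apply/seteqP; split=> [x /existsNP[i /not_implyP[_ nG]]|x [n _]].
  by exists (pickle i) => //; rewrite pickleK.
by case: (unpickle n) => // i nG nGx; apply: nG; exact: nGx.
Qed.

Lemma Sigma0_3_bigcup_bigcap (A : set X) : Sigma0 3 A ->
  exists2 G : nat -> nat -> set X, (forall i j, open (G i j)) &
    A = \bigcup_i \bigcap_j G i j.
Proof.
move=> [F FS ->].
have FE i : exists G : nat -> set X, (forall j, open (~` G j)) /\ ~` F i = \bigcup_j G j.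
  by have [G Gop GE] := FS i; exists G.
have [G GP] := choice FE.
exists (fun i j => ~` G i j); first by move=> i j; exact: (GP i).1.
by apply: eq_bigcupr => i _; rewrite -setC_bigcup -(GP i).2 setCK.
Qed.

End BorelComplexity.

Lemma not_to_infinity (a : nat -> nat) : ~ to_infinity a ->
  exists v, forall n, exists2 k, (n <= k)%N & a k = v.
Proof.
move=> na; apply: contrapT => H; apply: na.
have av v : exists n, forall k, (n <= k)%N -> a k <> v.
  apply: contrapT => Hv; apply: H; exists v => n; apply: contrapT => Hn; apply: Hv.
  by exists n => k nk akv; apply: Hn; exists k.
elim=> [|i [n nP]]; first by exists 0%N.
have [m mP] := av i; exists (maxn n m) => k; rewrite geq_max => /andP[nk mk].
by rewrite ltn_neqAle nP// andbT; apply/eqP => /esym; exact: mP.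
Qed.

Section QuasiRegularSet.
Context {R : realType} {X : completeMetricType R} (T : X -> X).
Hypothesis cT : continuous T.

Lemma separable_dense_sequence : separable X ->
  exists c_ : nat -> X, forall (y : X) (e : R), 0 < e -> exists i, mdist y (c_ i) < e.
Proof.
move=> [D cD dD].
have near_D (y : X) (e : R) : 0 < e -> exists2 z, D z & mdist y z < e.
  move=> e0; have [||z [zy Dz]] := dD (interior [set z | mdist y z < e]).
  - exists y; rewrite /interior; apply/near_mdist; exists e => //.
  - exact: open_interior.
  - by exists z => //; exact: (interior_subset zy).
have /pfcard_geP[D0|[f]] := cD.
  by have [z] := near_D point 1 ltr01; rewrite D0.
exists f => y e /(near_D y)[z Dz yz].
by have [i _ fi] := 'surj_f Dz; exists i; rewrite fi.
Qed.

Variable c_ : nat -> X.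
Hypothesis c_dense : forall (y : X) (e : R), 0 < e -> exists i, mdist y (c_ i) < e.

Lemma quasi_regular_iff x : quasi_regular_set R T x <->
  (forall s N L, cvg (birkhoff_avg T (test_fun c_ s N L) k x @[k --> \oo])) /\
  tight_orbit c_ T x.
Proof.
split=> [Qx|[cx tx]]; last exact: tight_quasi_regular tx cx.
split; last exact: (quasi_regular_tight c_dense Qx).
by move=> s N L; apply: quasi_regular_cvg => //; exact: test_fun_bounded_continuous.
Qed.

(** Comparison with the single term [u n] leaves, for fixed [e] and [n], an intersection of closed
    conditions on the averages. *)
Lemma cvg_iff_harmonic_cauchy (u : nat -> R) : cvg (u k @[k --> \oo]) <->
  forall e : nat, exists n, forall k, (n <= k)%N -> `|u k - u n| <= e.+1%:R^-1.
Proof.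
split=> [/cvg_ex[l /cvgrPdist_lt cl] e|H].
  have e0 : 0 < e.+1%:R^-1 / 2 :> R by rewrite divr_gt0// invr_gt0.
  have [n _ nP] := cl _ e0; exists n => k nk.
  have := nP k nk; have := nP n (leqnn n); rewrite /= => h1 h2.
  rewrite -(subrKA l) (le_trans (ler_normD _ _))// [X in X + _]distrC.
  by rewrite [leRHS]splitr lerD// ltW.
apply: cauchy_cvg; apply: cauchy_exP => e e0.
have [m mP] := harmonic_small e0; have [n nP] := H m.
exists (u n); exists n => // k /= nk; rewrite /ball /= distrC.
by apply: le_lt_trans (nP k nk) (mP m (leqnn m)).
Qed.

Lemma quasi_regular_Pi0_3 : Pi0 3 (quasi_regular_set R T).
Proof.
pose I : countType := ((seq (nat * nat) * nat * nat * nat) + (nat * nat))%type.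
pose G (i : I) (n : nat) : set X := match i with
  | inl (s, N, L, e) => [set x | forall k, (n <= k)%N ->
      `|birkhoff_avg T (test_fun c_ s N L) k x - birkhoff_avg T (test_fun c_ s N L) n x|
        <= e.+1%:R^-1]
  | inr (L, e) => [set x | forall k, (0 < k)%N ->
      1 - e.+1%:R^-1 <= birkhoff_avg T (cover c_ L n) k x] end.
have avgc s N L k : continuous (birkhoff_avg T (test_fun c_ s N L) k).
  by apply: avg_bounded_continuous => //; exact: test_fun_bounded_continuous.
apply: (@Pi0_3_bigcap_bigcup _ I G).
  move=> [[[[s N] L] e]|[L e]] n /=.
    rewrite (_ : [set _ | _] = \bigcap_(k in [set k | (n <= k)%N])
      ((fun x => `|birkhoff_avg T (test_fun c_ s N L) k x
         - birkhoff_avg T (test_fun c_ s N L) n x|) @^-1` [set r : R | r <= e.+1%:R^-1])).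
      apply: closed_bigI => k _; apply: preimage_closed; last exact: closed_le.
      by move=> x _; apply: cvg_norm; apply: cvgB; exact: avgc.
    by apply/seteqP; split.
  rewrite (_ : [set _ | _] = \bigcap_(k in [set k | (0 < k)%N])
      (birkhoff_avg T (cover c_ L n) k @^-1` [set r : R | 1 - e.+1%:R^-1 <= r])).
    apply: closed_bigI => k _; apply: preimage_closed; last exact: closed_ge.
    by move=> x _; exact: avgc.
  by apply/seteqP; split.
apply/seteqP; split=> [x /quasi_regular_iff[cx tx]|x Gx].
  move=> [[[[s N] L] e]|[L e]] _.
    by have [n nP] := (cvg_iff_harmonic_cauchy _).1 (cx s N L) e; exists n.
  have [|M MP] := tx L e.+1%:R^-1; first by rewrite invr_gt0.
  by exists M.
apply/quasi_regular_iff; split=> [s N L|L e e0].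
  apply/cvg_iff_harmonic_cauchy => e.
  by have [n _ nP] := Gx (inl (s, N, L, e)) Logic.I; exists n.
have [m mP] := harmonic_small e0.
have [M _ MP] := Gx (inr (L, m)) Logic.I; exists M => k k0.
apply: le_trans (MP k k0); rewrite lerD2l lerN2.
exact: ltW (mP m (leqnn m)).
Qed.

(** Tightness of [mu] at one scale: the covers tend pointwise to 1. *)
Lemma mean_cover_large (mu : probability (borel_type X) R) L (e : R) : 0 < e ->
  exists M, 1 - e < mean mu (cover c_ L M).
Proof.
move=> e0.
have := @mean_cvg_measure R X mu (cover c_ L) setT measurableT.
rewrite [X in fine X](probability_setT mu) => h.
have /cvgrPdist_lt/(_ e e0)[n _ nP] : mean mu (cover c_ L M) @[M --> \oo] --> (1 : R).
  apply: h.
  - by move=> n; exact: test_fun_continuous.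
  - by move=> n; exact: test_fun_unit.
  - move=> x; have [M [d d0 dP]] := cover_local c_dense L x.
    rewrite indicT; apply: cvg_near_cst; exists M => // M' /= MM'.
    by apply: dP => //; rewrite mdistxx.
exists n; have := nP n (leqnn n); rewrite /= ltr_norml => /andP[? ?]; lra.
Qed.

Lemma quasi_regular_not_Sigma0_3 :
  strong_approximate_product_structure T -> two_invariant_measures R T ->
  ~ Sigma0 3 (quasi_regular_set R T).
Proof.
move=> saps [mu [nu [imu inu [A mA muA]]]] /Sigma0_3_bigcup_bigcap[G Gop QE].
have [f [f01 flip fsep]] := lip_separation mA muA.
(* Index 0 carries the separating function that drives the oscillation; the others enumerate the
   test functions, with [f] as default for numbers that encode nothing. *)
pose h j := if j is j'.+1 then
    (if unpickle j' is Some (s, N, L) then test_fun c_ s N L else f) else f.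
have h01 j : unit_valued (h j).
  by case: j => [|j] //=; case: (unpickle j) => [[[s N] L]|] //; exact: test_fun_unit.
have hlip j : exists c, lip c (h j).
  case: j => [|j] //=; case: (unpickle j) => [[[s N] L]|] //.
  by exists L%:R; exact: test_fun_lip.
have [Y [Ycont Yreg Yirr]] := reduction cT saps imu inu h01 hlip fsep.
apply: (@to_infinity_not_Sigma3 (fun i j => [set a | G i j (Y a)])).
  move=> i j a /= GY.
  have /near_mdist[e e0 eP] := open_nbhs_nbhs (conj (Gop i j) GY).
  by have [n nP] := Ycont a e e0; exists n => b /nP; exact: eP.
move=> a.
have -> : (exists i, forall j, G i j (Y a)) <-> quasi_regular_set R T (Y a).
  by rewrite QE; split=> [[i iP]|[i _ iP]]; exists i => // j; exact: iP.
split=> [ainf|Qa].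
  have cva s N L : birkhoff_avg T (test_fun c_ s N L) k (Y a) @[k --> \oo]
      --> mean mu (test_fun c_ s N L).
    have := Yreg a ainf (pickle (s, N, L)).+1.
    by rewrite /h pickleK.
  apply/quasi_regular_iff; split=> [s N L|]; first by apply/cvg_ex; eexists; exact: cva.
  apply: (eventually_tight_orbit c_dense) => L e e0.
  have [M MP] := mean_cover_large mu L e0; exists M.
  have d0 : 0 < mean mu (cover c_ L M) - (1 - e) by rewrite subr_gt0.
  (* A cover is itself a test function, so its averages along [Y a] approach a mean above
     [1 - e]. *)
  have /cvgrPdist_lt/(_ _ d0)[n _ nP] := cva [seq (l, 2)%N | l <- iota 0 M] 0%N L.
  exists n => k nk; have := nP k nk; rewrite /= -/(cover c_ L M) ltr_norml => /andP[? ?].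
  by lra.
apply: contrapT => /not_to_infinity[v vP].
apply: (Yirr a v vP); apply: quasi_regular_cvg => //.
apply: unit_bounded_continuous => //.
by case: flip => c; exact: lip_continuous.
Qed.

End QuasiRegularSet.

Theorem corollary32 (R : realType) (X : completeMetricType R) (T : X -> X)
    (sepX : separable X) (contT : continuous T)
    (sapsT : strong_approximate_product_structure T)
    (twoT : two_invariant_measures R T) :
  (Pi0_hard 3 (quasi_regular_set R T) /\
   Pi0_complete 3 (quasi_regular_set R T)) /\
  (Sigma0_hard 3 (irregular_set R T) /\
   Sigma0_complete 3 (irregular_set R T)).
Proof.
have [c_ c_dense] := separable_dense_sequence sepX.
have pi3 := quasi_regular_Pi0_3 contT c_dense.
have nsig := quasi_regular_not_Sigma0_3 contT c_dense sapsT twoT.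
have sig3 : Sigma0 3 (irregular_set R T).
  by move: pi3; rewrite /Pi0 /= /quasi_regular_set setCK.
by split; split=> //; split.
Qed.
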